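(* Let $P\subset\mathbb{R}^m$ with $\bar p\in P$, and consider the split system $g(p,x)=(g_1(p,x),g_2(p,x))\in C_1\times C_2=C$, $g_i$ with values in $\mathbb{R}^{l_i}$, $C_i\subset\mathbb{R}^{l_i}$ closed, $l_1+l_2=l$, where $g$ is defined on a neighborhood of $(\bar p,\bar x)$ in $\mathbb{R}^m\times\mathbb{R}^n$, is twice differentiable at $(\bar p,\bar x)\in\operatorname{gph}\Gamma$, and satisfies the standing assumptions. Suppose: (a) for every $w\in T_P(\bar p)$ and every sequence $\tau_k\downarrow0$ there is $u\in\mathbb{R}^n$ with $\liminf_{k\to\infty}\operatorname{dist}(g(\bar p,\bar x)+\tau_k\nabla g(\bar p,\bar x)(w,u);C)/\tau_k=0$; (b) Robinson stability holds at $(\bar p,\bar x)$ for the subsystem $g_2(p,x)\in C_2$, $p\in P$; (c) for every triple $(w,u,\lambda)\in\mathbb{R}^m\times\mathbb{R}^n\times\mathbb{R}^l$ satisfying $(w,u)\ne(0,0)$, $w\in T_P(\bar p)$, $\nabla g(\bar p,\bar x)(w,u)\in T_C(g(\bar p,\bar x))$, $\lambda\in N_C(g(\bar p,\bar x);\nabla g(\bar p,\bar x)(w,u))$, $\nabla_xg(\bar p,\bar x)^T\lambda=0$, and $\tfrac12\langle\nabla^2\langle\lambda,g\rangle(\bar p,\bar x)(w,u),(w,u)\rangle+\overline\chi_P(\nabla_pg(\bar p,\bar x)^T\lambda,\bar p;w)\ge\underline\chi_C(\lambda,g(\bar p,\bar x);\nabla g(\bar p,\bar x)(w,u))$, one has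 $\lambda^1=0$, where $\lambda=(\lambda^1,\lambda^2)\in\mathbb{R}^{l_1}\times\mathbb{R}^{l_2}$. Then Robinson stability holds at $(\bar p,\bar x)$ for the whole system $g(p,x)\in C$, $p\in P$.
   Context: $\Gamma(p)=\{x:g(p,x)\in C\}$ for $p\in P$. Standing assumptions: there are neighborhoods $U$ of $\bar x$ and $V$ of $\bar p$ (relative to $P$) such that for each $p\in V$ the map $g(p,\cdot)$ is continuously differentiable on $U$, and $g$, $\nabla_xg$ are continuous at $(\bar p,\bar x)$. $\nabla g(\bar p,\bar x)(w,u)=\nabla_pg(\bar p,\bar x)w+\nabla_xg(\bar p,\bar x)u$; $\langle\lambda,g\rangle(p,x)=\langle\lambda,g(p,x)\rangle$. Robinson stability of a system $h(p,x)\in K$, $p\in P$, at $(\bar p,\bar x)$: there exist $\kappa\ge0$ and neighborhoods $U$ of $\bar x$, $V$ of $\bar p$ in $P$ with $\operatorname{dist}(x;\{\xi:h(p,\xi)\in K\})\le\kappa\operatorname{dist}(h(p,x);K)$ for all $(p,x)\in V\times U$. Upper curvature $\overline\chi_\Omega(\lambda,\bar z;v):=\lim_{\epsilon\downarrow0}\sup\{\langle\lambda,v'-v\rangle/\tau: 0<\tau<\epsilon,\|v'-v\|<\epsilon,\bar z+\tau v'\in\Omega\}$; lower curvature $\underline\chi_\Omega(\lambda,\bar z;v):=\lim_{\epsilon\downarrow0}\inf\{\langle\lambda,v'-v\rangle/\tau: 0<\tau<\epsilon,\|v'-v\|<\epsilon,\operatorname{dist}(\lambda;N_\Omega(\bar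 z+\tau v'))<\epsilon\}$ ($\sup\emptyset=-\infty$, $\inf\emptyset=+\infty$, $N_\Omega(z)=\emptyset$ off $\Omega$). $T$ is the contingent cone, $N$ the limiting normal cone, and $N_\Omega(\bar z;w)=\{v:\exists t_k\downarrow0,w_k\to w,v_k\to v,\ \bar z+t_kw_k\in\Omega,\ v_k\in\widehat N_\Omega(\bar z+t_kw_k)\}$ the directional limiting normal cone ($\widehat N$ regular normal cone). *)

(* Defs.v *)
From mathcomp Require Import ssreflect ssrfun ssrbool eqtype ssrnat seq fintype bigop.
From Stdlib Require Import Reals ClassicalEpsilon.
Set Implicit Arguments.
Unset Strict Implicit.
Local Open Scope R_scope.

Definition Vec (n : nat) := 'I_n -> R.
Definition vzero {n} : Vec n := fun _ => 0.
Definition vadd {n} (a b : Vec n) : Vec n := fun i => a i + b i.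
Definition vsub {n} (a b : Vec n) : Vec n := fun i => a i - b i.
Definition vscal {n} (t : R) (a : Vec n) : Vec n := fun i => t * a i.
Definition dot {n} (a b : Vec n) : R := \big[Rplus/0]_(i < n) (a i * b i).
Definition vnorm {n} (a : Vec n) : R := sqrt (dot a a).
Definition nrm2 {m n} (w : Vec m) (u : Vec n) : R := sqrt (dot w w + dot u u).
Definition ebasis {n} (j : 'I_n) : Vec n := fun i => if i == j then 1 else 0.

Definition vfst {l1 l2} (y : Vec (l1 + l2)) : Vec l1 := fun j => y (lshift l2 j).
Definition vsnd {l1 l2} (y : Vec (l1 + l2)) : Vec l2 := fun j => y (rshift l1 j).
Definition setprod {l1 l2} (C1 : Vec l1 -> Prop) (C2 : Vec l2 -> Prop)
  : Vec (l1 + l2) -> Prop := fun y => C1 (vfst y) /\ C2 (vsnd y).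

Definition adj {n l} (A : Vec n -> Vec l) (lam : Vec l) : Vec n :=
  fun j => dot lam (A (ebasis j)).

Definition closed {n} (S : Vec n -> Prop) : Prop :=
  forall y, (forall eps, 0 < eps -> exists z, S z /\ vnorm (vsub y z) < eps) -> S y.

Definition vconv {n} (a : nat -> Vec n) (v : Vec n) : Prop :=
  forall eps, 0 < eps -> exists N, forall k, (N <= k)%nat -> vnorm (vsub (a k) v) < eps.
Definition downto0 (t : nat -> R) : Prop :=
  (forall k, 0 < t k) /\ forall eps, 0 < eps -> exists N, forall k, (N <= k)%nat -> t k < eps.

Inductive ER := Fin (r : R) | PInf | MInf.
Definition ER_le (a b : ER) : Prop :=
  match a, b with
  | MInf, _ => True
  | _, PInf => True
  | Fin x, Fin y => x <= y
  | _, _ => False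
  end.
Definition ER_lt (a b : ER) : Prop := ER_le a b /\ a <> b.
Definition is_lub (E : ER -> Prop) (s : ER) : Prop :=
  (forall x, E x -> ER_le x s) /\ (forall b, (forall x, E x -> ER_le x b) -> ER_le s b).
Definition is_glb (E : ER -> Prop) (s : ER) : Prop :=
  (forall x, E x -> ER_le s x) /\ (forall b, (forall x, E x -> ER_le b x) -> ER_le b s).
(* sup / inf in the complete lattice of extended reals (sup empty = -oo, inf empty = +oo) *)
Definition ER_sup (E : ER -> Prop) : ER := epsilon (inhabits PInf) (is_lub E).
Definition ER_inf (E : ER -> Prop) : ER := epsilon (inhabits PInf) (is_glb E).
Definition ER_addr (r : R) (a : ER) : ER :=
  match a with Fin x => Fin (r + x) | PInf => PInf | MInf => MInf end.
(* multiplication by a nonnegative real (convention: t * (+oo) = +oo) *)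
Definition ER_scale (t : R) (a : ER) : ER :=
  match a with Fin x => Fin (t * x) | PInf => PInf | MInf => MInf end.
Definition ER_liminf (a : nat -> ER) : ER :=
  ER_sup (fun s => exists N, s = ER_inf (fun y => exists k, (N <= k)%nat /\ y = a k)).

(* distance to a set (= +oo for the empty set) *)
Definition vdist {n} (x : Vec n) (S : Vec n -> Prop) : ER :=
  ER_inf (fun y => exists z, S z /\ y = Fin (vnorm (vsub x z))).

Definition tangent {n} (O : Vec n -> Prop) (z : Vec n) (w : Vec n) : Prop :=
  exists (t : nat -> R) (wk : nat -> Vec n),
    downto0 t /\ vconv wk w /\ forall k, O (vadd z (vscal (t k) (wk k))).
Definition reg_normal {n} (O : Vec n -> Prop) (z : Vec n) (v : Vec n) : Prop :=
  O z /\ forall eps, 0 < eps -> exists delta, 0 < delta /\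
    forall z', O z' -> vnorm (vsub z' z) < delta ->
      dot v (vsub z' z) <= eps * vnorm (vsub z' z).
Definition lim_normal {n} (O : Vec n -> Prop) (z : Vec n) (v : Vec n) : Prop :=
  O z /\ exists (zk vk : nat -> Vec n),
    vconv zk z /\ vconv vk v /\ forall k, O (zk k) /\ reg_normal O (zk k) (vk k).
Definition dir_normal {n} (O : Vec n -> Prop) (z w : Vec n) (v : Vec n) : Prop :=
  exists (t : nat -> R) (wk vk : nat -> Vec n),
    downto0 t /\ vconv wk w /\ vconv vk v /\
    forall k, O (vadd z (vscal (t k) (wk k))) /\
              reg_normal O (vadd z (vscal (t k) (wk k))) (vk k).

(* upper curvature: lim_{eps -> 0} sup {...}; the sup is nonincreasing as eps
   decreases, so the limit is the inf over eps > 0 *)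
Definition chi_up {n} (O : Vec n -> Prop) (lam z v : Vec n) : ER :=
  ER_inf (fun s => exists eps, 0 < eps /\
    s = ER_sup (fun y => exists tau v', 0 < tau /\ tau < eps /\
          vnorm (vsub v' v) < eps /\ O (vadd z (vscal tau v')) /\
          y = Fin (dot lam (vsub v' v) / tau))).
(* lower curvature: lim_{eps -> 0} inf {...} = sup over eps > 0 *)
Definition chi_low {n} (O : Vec n -> Prop) (lam z v : Vec n) : ER :=
  ER_sup (fun s => exists eps, 0 < eps /\
    s = ER_inf (fun y => exists tau v', 0 < tau /\ tau < eps /\
          vnorm (vsub v' v) < eps /\
          ER_lt (vdist lam (lim_normal O (vadd z (vscal tau v')))) (Fin eps) /\
          y = Fin (dot lam (vsub v' v) / tau))).

Definition linear2 {m n l} (L : Vec m -> Vec n -> Vec l) : Prop :=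
  forall a b w1 u1 w2 u2,
    L (vadd (vscal a w1) (vscal b w2)) (vadd (vscal a u1) (vscal b u2))
    = vadd (vscal a (L w1 u1)) (vscal b (L w2 u2)).
Definition linear1 {n l} (L : Vec n -> Vec l) : Prop :=
  forall a b u1 u2, L (vadd (vscal a u1) (vscal b u2)) = vadd (vscal a (L u1)) (vscal b (L u2)).
Definition frechet2 {m n l} (f : Vec m -> Vec n -> Vec l) (L : Vec m -> Vec n -> Vec l)
  (p0 : Vec m) (x0 : Vec n) : Prop :=
  linear2 L /\ forall eps, 0 < eps -> exists delta, 0 < delta /\
    forall w u, nrm2 w u < delta ->
      vnorm (vsub (vsub (f (vadd p0 w) (vadd x0 u)) (f p0 x0)) (L w u)) <= eps * nrm2 w u.
Definition frechet1 {n l} (f : Vec n -> Vec l) (L : Vec n -> Vec l) (x0 : Vec n) : Prop :=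
  linear1 L /\ forall eps, 0 < eps -> exists delta, 0 < delta /\
    forall u, vnorm u < delta ->
      vnorm (vsub (vsub (f (vadd x0 u)) (f x0)) (L u)) <= eps * vnorm u.

Definition robinson_stable {m n l} (P : Vec m -> Prop) (h : Vec m -> Vec n -> Vec l)
  (K : Vec l -> Prop) (pb : Vec m) (xb : Vec n) : Prop :=
  exists kappa r, 0 <= kappa /\ 0 < r /\
    forall p x, P p -> vnorm (vsub p pb) < r -> vnorm (vsub x xb) < r ->
      ER_le (vdist x (fun xi => K (h p xi))) (ER_scale kappa (vdist (h p x) K)).

(* Main.v *)
(* Suppose stability fails.  Condition (a) and the solvability claim below give points of
   Gamma(p) within O(|p - pb|) of xb, so the failing points (p_k, x_k) have residuals
   o(tau_k), where tau_k = |(p_k, x_k) - (pb, xb)|, and a subsequence has a limit direction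
   (w, u) <> 0.  The claim is that near such a direction a residual o(rho) with rho = o(tau)
   forces a solution within distance rho.  Otherwise, minimising a weighted residual plus a
   small quadratic over the ball of radius rho gives almost stationary points with multipliers
   lambda_k, normal to C at y_k.  Robinson stability of the second subsystem acts as an exact
   penalty, so the first components of the lambda_k stay away from zero.  A limit lambda
   satisfies the first-order relations in (c), and the second-order expansion of g along the
   sequence, together with <lambda, g(p_k, x_k) - y_k> >= 0, gives the curvature inequality;
   hence (c) forces lambda^1 = 0, a contradiction. *)
Require Import Defs.
From HB Require Import structures.
From mathcomp Require Import ssreflect ssrfun ssrbool eqtype ssrnat seq fintype bigop.
From Stdlib Require Import Reals Lra Classical ClassicalEpsilon FunctionalExtensionality.
Local Open Scope R_scope.

(** The curvature inequality is of order tau^2, while the residual G(z_k) - y_k is only known to be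
    o(tau). It cannot be estimated away; it has to be dropped by its sign, and that sign is needed
    for the limit lambda, because nothing is known about the speed of lambda_k -> lambda. This
    shapes the penalty: a Euclidean norm with one weight per block is smooth off zero, and its
    gradient is, block by block, a positive multiple of the residual. So the residual blocks are
    nonnegative multiples of those of lambda_k and, for large k, pair nonnegatively with those of
    lambda. As C need not be convex, the point y of C is a variable of the minimisation rather than
    a projection; optimality in y alone puts the multiplier into the regular normal cone at y. The
    solvability claim leaves the radius rho free because it serves at two radii: a fixed multiple of
    tau, which makes true solutions out of the approximate ones in (a), and a fixed multiple of the
    residual, which is the error bound that contradicts the failure of stability. *)

Fact Rplus_assocr : associative Rplus.
Proof. by move=> x y z; rewrite Rplus_assoc. Qed.
HB.instance Definition _ := Monoid.isComLaw.Build R 0 Rplus Rplus_assocr Rplus_comm Rplus_0_l.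

Ltac vring :=
  apply: functional_extensionality => ?; rewrite /vadd /vsub /vscal /vzero; ring.

(** * Euclidean geometry in coordinates *)

Section Vectors.
Context {n : nat}.
Implicit Types a b c : Vec n.

Lemma sum_Rmult t (F : 'I_n -> R) :
  \big[Rplus/0]_(i < n) (t * F i) = t * \big[Rplus/0]_(i < n) F i.
Proof. by elim/big_rec2: _ => [|i x y _ ->]; ring. Qed.

Lemma sum_Rle (F G : 'I_n -> R) : (forall i, F i <= G i) ->
  \big[Rplus/0]_(i < n) F i <= \big[Rplus/0]_(i < n) G i.
Proof. by move=> H; elim/big_rec2: _ => [|i x y _ h]; [lra | move: (H i); lra]. Qed.

Lemma sum_Rge0 (F : 'I_n -> R) : (forall i, 0 <= F i) -> 0 <= \big[Rplus/0]_(i < n) F i.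
Proof. by move=> H; elim/big_rec: _ => [|i x _ h]; [lra | move: (H i); lra]. Qed.

Lemma sum_Rge_term (F : 'I_n -> R) j : (forall i, 0 <= F i) ->
  F j <= \big[Rplus/0]_(i < n) F i.
Proof.
move=> H; rewrite (bigD1 j) //=.
rewrite -{1}(Rplus_0_r (F j)); apply: Rplus_le_compat_l.
by elim/big_rec: _ => [|i x _ h]; [lra | move: (H i); lra].
Qed.

Lemma dotC a b : dot a b = dot b a.
Proof. by apply: eq_bigr => i _; ring. Qed.

Lemma dot_addl a b c : dot (vadd a b) c = dot a c + dot b c.
Proof. by rewrite /dot -big_split; apply: eq_bigr => i _; rewrite /vadd /=; ring. Qed.

Lemma dot_scall t a c : dot (vscal t a) c = t * dot a c.
Proof. by rewrite /dot -sum_Rmult; apply: eq_bigr => i _; rewrite /vscal; ring. Qed.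

Lemma dot_subl a b c : dot (vsub a b) c = dot a c - dot b c.
Proof.
have -> : vsub a b = vadd a (vscal (-1) b) by vring.
by rewrite dot_addl dot_scall; ring.
Qed.

Lemma dot_addr a b c : dot a (vadd b c) = dot a b + dot a c.
Proof. by rewrite dotC dot_addl !(dotC a). Qed.

Lemma dot_scalr t a c : dot a (vscal t c) = t * dot a c.
Proof. by rewrite dotC dot_scall (dotC a). Qed.

Lemma dot_subr a b c : dot a (vsub b c) = dot a b - dot a c.
Proof. by rewrite dotC dot_subl !(dotC a). Qed.

Lemma dot0l a : dot vzero a = 0.
Proof. have -> : @vzero n = vscal 0 a by vring.
by rewrite dot_scall; ring. Qed.

Lemma dot0r a : dot a vzero = 0.
Proof. by rewrite dotC dot0l. Qed.

Definition dotE := (dot_addl, dot_addr, dot_subl, dot_subr, dot_scall, dot_scalr).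

Lemma dot_ge0 a : 0 <= dot a a.
Proof. by apply: sum_Rge0 => i; nra. Qed.

Lemma vnorm_ge0 a : 0 <= vnorm a.
Proof. exact: sqrt_pos. Qed.

Lemma vnorm_sq a : vnorm a * vnorm a = dot a a.
Proof. exact/sqrt_sqrt/dot_ge0. Qed.

Lemma vnorm_le_sq a t : 0 <= t -> dot a a <= t * t -> vnorm a <= t.
Proof. by move=> t0 h; move: (vnorm_ge0 a) (vnorm_sq a); nra. Qed.

Lemma vnorm_eq0 a : vnorm a = 0 -> a = vzero.
Proof.
move=> h; apply: functional_extensionality => i; rewrite /vzero.
have: a i * a i <= dot a a by apply: (sum_Rge_term (fun i => a i * a i)) => j; nra.
by rewrite -vnorm_sq h; nra.
Qed.

Lemma coord_le_vnorm a i : Rabs (a i) <= vnorm a.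
Proof.
have: a i * a i <= dot a a by apply: (sum_Rge_term (fun i => a i * a i)) => j; nra.
rewrite -vnorm_sq; move: (vnorm_ge0 a) => h0 h.
by apply: Rabs_le; nra.
Qed.

Lemma cauchy_schwarz a b : dot a b <= vnorm a * vnorm b.
Proof.
(* This square equals [2 * |a| * |b| * (|a| * |b| - dot a b)]; the zero cases are split off so that
   the factor can be cancelled. *)
have := dot_ge0 (vsub (vscal (vnorm b) a) (vscal (vnorm a) b)).
rewrite !dotE (dotC b a) -!vnorm_sq.
have [/vnorm_eq0 ->|ha] : vnorm a = 0 \/ 0 < vnorm a by move: (vnorm_ge0 a); lra.
  by rewrite dot0l => _; move: (vnorm_ge0 (@vzero n)) (vnorm_ge0 b); nra.
have [/vnorm_eq0 ->|hb] : vnorm b = 0 \/ 0 < vnorm b by move: (vnorm_ge0 b); lra.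
  by rewrite dot0r => _; move: (vnorm_ge0 (@vzero n)) (vnorm_ge0 a); nra.
move=> h; have: 0 <= (2 * (vnorm a * vnorm b)) * (vnorm a * vnorm b - dot a b) by nra.
by move: (Rmult_lt_0_compat _ _ ha hb); nra.
Qed.

Lemma vnorm_scal t a : vnorm (vscal t a) = Rabs t * vnorm a.
Proof.
rewrite /vnorm !dotE -Rmult_assoc sqrt_mult; [|nra|exact: dot_ge0].
by rewrite sqrt_Rsqr_abs.
Qed.

Lemma vnorm_opp_sub a b : vnorm (vsub a b) = vnorm (vsub b a).
Proof.
have -> : vsub a b = vscal (-1) (vsub b a) by vring.
by rewrite vnorm_scal Rabs_Ropp Rabs_R1; ring.
Qed.

Lemma cauchy_schwarz_abs a b : Rabs (dot a b) <= vnorm a * vnorm b.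
Proof.
apply: Rabs_le; split; last exact: cauchy_schwarz.
move: (cauchy_schwarz (vscal (-1) a) b); rewrite dotE vnorm_scal Rabs_Ropp Rabs_R1; lra.
Qed.

Lemma vnorm_triangle a b : vnorm (vadd a b) <= vnorm a + vnorm b.
Proof.
move: (vnorm_ge0 a) (vnorm_ge0 b) => ha hb.
apply: vnorm_le_sq; first lra.
by rewrite !dotE (dotC b a) -!vnorm_sq; move: (cauchy_schwarz a b); nra.
Qed.

Lemma vnorm_sub_triangle b a c : vnorm (vsub a c) <= vnorm (vsub a b) + vnorm (vsub b c).
Proof.
have -> : vsub a c = vadd (vsub a b) (vsub b c) by vring.
exact: vnorm_triangle.
Qed.

Lemma vnorm_le_sub a b : vnorm a <= vnorm b + vnorm (vsub a b).
Proof.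
have {1}-> : a = vadd b (vsub a b) by vring.
exact: vnorm_triangle.
Qed.

Lemma vnorm0 : vnorm (@vzero n) = 0.
Proof. by rewrite /vnorm dot0l sqrt_0. Qed.

Lemma vnorm_subxx a : vnorm (vsub a a) = 0.
Proof.
by have -> : vsub a a = vzero; [vring | exact: vnorm0].
Qed.

Lemma vnorm_le_sum a : vnorm a <= \big[Rplus/0]_(i < n) Rabs (a i).
Proof.
apply: vnorm_le_sq; first by apply: sum_Rge0 => i; exact: Rabs_pos.
set s := \big[_/_]_(_ < _) _.
rewrite /dot /s -sum_Rmult; apply: sum_Rle => i.
have -> : a i * a i = Rabs (a i) * Rabs (a i) by rewrite -Rabs_mult Rabs_right //; nra.
by apply: Rmult_le_compat_r; [exact: Rabs_pos | apply: (sum_Rge_term (fun i => Rabs (a i))) => j; exact: Rabs_pos].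
Qed.

Lemma vec_basis a : a = \big[vadd/vzero]_(j < n) vscal (a j) (ebasis j).
Proof.
apply: functional_extensionality => i.
have -> : (\big[vadd/vzero]_(j < n) vscal (a j) (ebasis j)) i
  = \big[Rplus/0]_(j < n) (a j * (if i == j then 1 else 0)).
  by elim/big_rec2: _ => // j x y _ <-.
rewrite (bigD1 i) //= eqxx big1 => [|j]; first by ring.
by rewrite eq_sym => /negbTE ->; ring.
Qed.

End Vectors.

(** * Product spaces as packed vectors *)

Section Pairs.
Context {m n : nat}.

Definition vpack (a : Vec m) (b : Vec n) : Vec (m + n) :=
  fun i => match fintype.split i with inl j => a j | inr j => b j end.

Lemma vfst_vpack a b : vfst (vpack a b) = a.
Proof.
apply: functional_extensionality => j; rewrite /vfst /vpack.
by rewrite (unsplitK (inl j : 'I_m + 'I_n)%type).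
Qed.

Lemma vsnd_vpack a b : vsnd (vpack a b) = b.
Proof.
apply: functional_extensionality => j; rewrite /vsnd /vpack.
by rewrite (unsplitK (inr j : 'I_m + 'I_n)%type).
Qed.

Lemma vpackE (z : Vec (m + n)) : vpack (vfst z) (vsnd z) = z.
Proof.
apply: functional_extensionality => i; rewrite /vpack /vfst /vsnd.
by case: splitP => j h; congr z; apply: val_inj.
Qed.

Lemma dot_pair (a b : Vec (m + n)) : dot a b = dot (vfst a) (vfst b) + dot (vsnd a) (vsnd b).
Proof. by rewrite /dot big_split_ord. Qed.

Lemma vnorm_nrm2 (z : Vec (m + n)) : vnorm z = nrm2 (vfst z) (vsnd z).
Proof. by rewrite /vnorm dot_pair. Qed.

Lemma vnorm_vfst (z : Vec (m + n)) : vnorm (vfst z) <= vnorm z.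
Proof.
apply: vnorm_le_sq; first exact: vnorm_ge0.
by rewrite vnorm_sq dot_pair; move: (dot_ge0 (vsnd z)); lra.
Qed.

Lemma vnorm_vsnd (z : Vec (m + n)) : vnorm (vsnd z) <= vnorm z.
Proof.
apply: vnorm_le_sq; first exact: vnorm_ge0.
by rewrite vnorm_sq dot_pair; move: (dot_ge0 (vfst z)); lra.
Qed.

Lemma vnorm_vpack_le (a : Vec m) (b : Vec n) : vnorm (vpack a b) <= vnorm a + vnorm b.
Proof.
move: (vnorm_ge0 a) (vnorm_ge0 b) => ha hb.
apply: vnorm_le_sq; first lra.
by rewrite dot_pair vfst_vpack vsnd_vpack -!vnorm_sq; nra.
Qed.

Lemma pair_ext (z z' : Vec (m + n)) : vfst z = vfst z' -> vsnd z = vsnd z' -> z = z'.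
Proof. by move=> h1 h2; rewrite -(vpackE z) h1 h2 vpackE. Qed.

Lemma vfst_add (a b : Vec (m + n)) : vfst (vadd a b) = vadd (vfst a) (vfst b).
Proof. by []. Qed.
Lemma vfst_sub (a b : Vec (m + n)) : vfst (vsub a b) = vsub (vfst a) (vfst b).
Proof. by []. Qed.
Lemma vfst_scal t (a : Vec (m + n)) : vfst (vscal t a) = vscal t (vfst a).
Proof. by []. Qed.
Lemma vsnd_add (a b : Vec (m + n)) : vsnd (vadd a b) = vadd (vsnd a) (vsnd b).
Proof. by []. Qed.
Lemma vsnd_sub (a b : Vec (m + n)) : vsnd (vsub a b) = vsub (vsnd a) (vsnd b).
Proof. by []. Qed.
Lemma vsnd_scal t (a : Vec (m + n)) : vsnd (vscal t a) = vscal t (vsnd a).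
Proof. by []. Qed.
End Pairs.

Definition pairE := (@vfst_add, @vfst_sub, @vfst_scal, @vsnd_add, @vsnd_sub, @vsnd_scal,
  @vfst_vpack, @vsnd_vpack).

(** * Sequences, compactness and existence of minimisers *)

Lemma inv_succ_gt0 k : 0 < / (INR k + 1).
Proof. by apply: Rinv_0_lt_compat; move: (pos_INR k); lra. Qed.

Lemma inv_succ_small eps : 0 < eps ->
  exists N, forall k, (N <= k)%nat -> / (INR k + 1) < eps.
Proof.
move=> e0; have [N hN] := INR_unbounded (/ eps).
exists N => k /leP /le_INR hk; rewrite -(Rinv_inv eps).
apply: Rinv_0_lt_contravar; first exact: Rinv_0_lt_compat.
lra.
Qed.

Lemma le_of_le_eps a b : (forall eps, 0 < eps -> a <= b + eps) -> a <= b.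
Proof. by move=> h; apply: le_epsilon. Qed.

Lemma fin_eventually {n} (Q : 'I_n -> nat -> Prop) :
  (forall i, exists N, forall k, (N <= k)%nat -> Q i k) ->
  exists N, forall k, (N <= k)%nat -> forall i, Q i k.
Proof.
move=> /(fun h => choice _ h) [f hf]; exists (\max_(i < n) f i)%nat => k hk i.
by apply: hf; apply: leq_trans hk; exact: leq_bigmax.
Qed.

Lemma fin_small {n} (Q : 'I_n -> R -> Prop) :
  (forall i, exists d, 0 < d /\ forall t, 0 < t -> t <= d -> Q i t) ->
  exists t, 0 < t /\ forall i, Q i t.
Proof.
move=> h; have [i|N hN] := @fin_eventually n (fun i k => Q i (/ (INR k + 1))).
  have [d [d0 hd]] := h i; have [N hN] := inv_succ_small _ d0.
  by exists N => k /hN hk; apply: hd; [exact: inv_succ_gt0 | lra].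
exists (/ (INR N + 1)); split; first exact: inv_succ_gt0.
exact: hN.
Qed.

Lemma vconv_coord {n} (a : nat -> Vec n) (l : Vec n) :
  (forall i eps, 0 < eps -> exists N, forall k, (N <= k)%nat -> Rabs (a k i - l i) < eps) ->
  vconv a l.
Proof.
move=> h eps e0; set d := eps / (INR n + 1).
have n0 := pos_INR n.
have d0 : 0 < d by apply: Rdiv_lt_0_compat; lra.
have [N hN] := @fin_eventually n (fun i k => Rabs (a k i - l i) < d) (fun i => h i d d0).
exists N => k /hN hk; apply: Rle_lt_trans (vnorm_le_sum _) _.
apply: (Rle_lt_trans _ (\big[Rplus/0]_(i < n) d)).
  by apply: sum_Rle => i; apply: Rlt_le; exact: hk.
have -> : \big[Rplus/0]_(i < n) d = INR n * d.
  rewrite big_const card_ord; elim: (n) => [|j IH]; first by rewrite /=; ring.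
  by rewrite iterS IH S_INR; ring.
have -> : eps = (INR n + 1) * d by rewrite /d; field; lra.
lra.
Qed.

(** The index map only has to dominate the identity: this already transfers eventual properties to
    the extracted sequence, and it is stable under composition. *)
Lemma real_bolzano_weierstrass (u : nat -> R) B : (forall k, Rabs (u k) <= B) ->
  exists (phi : nat -> nat) l, (forall k, (k <= phi k)%nat) /\
    forall eps, 0 < eps -> exists N, forall k, (N <= k)%nat -> Rabs (u (phi k) - l) < eps.
Proof.
move=> hB.
have [|l hl] := Bolzano_Weierstrass u (fun x => - B <= x <= B) (compact_P3 (- B) B).
  by move=> k; move: (hB k); rewrite /Rabs; case: Rcase_abs; lra.
have /choice [phi hphi] k : exists p, (k <= p)%nat /\ Rabs (u p - l) < / (INR k + 1).
  have [|p [/leP hp up]] := hl (disc l (mkposreal _ (inv_succ_gt0 k))) k.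
    by exists (mkposreal _ (inv_succ_gt0 k)).
  by exists p.
exists phi, l; split=> [k|eps /inv_succ_small[N hN]]; first by case: (hphi k).
by exists N => k /hN hk; case: (hphi k) => _ h; lra.
Qed.

Lemma bolzano_weierstrass {n} (a : nat -> Vec n) B : (forall k, vnorm (a k) <= B) ->
  exists (phi : nat -> nat) l, (forall k, (k <= phi k)%nat) /\ vconv (fun k => a (phi k)) l.
Proof.
move=> hB.
(* Extraction one coordinate at a time; later extractions preserve the limits already obtained. *)
have [phi [l [hphi hl]]] : exists (phi : nat -> nat) (l : Vec n),
    (forall k, (k <= phi k)%nat) /\ forall i, i \in enum 'I_n -> forall eps, 0 < eps ->
      exists N, forall k, (N <= k)%nat -> Rabs (a (phi k) i - l i) < eps.
  elim: (enum 'I_n) => [|j s [phi [l [hphi hl]]]]; first by exists (fun k => k), vzero.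
  have [|psi [x [hpsi hx]]] := real_bolzano_weierstrass (fun k => a (phi k) j) B.
    by move=> k; apply: Rle_trans (coord_le_vnorm _ _) (hB _).
  exists (fun k => phi (psi k)), (fun i => if i == j then x else l i); split.
    by move=> k; exact: leq_trans (hpsi k) (hphi _).
  move=> i; rewrite in_cons; case: eqP => [-> _|_ /= /hl h] eps; first exact: hx.
  by move=> /h[N hN]; exists N => k hk; apply: hN; exact: leq_trans hk (hpsi k).
exists phi, l; split=> //; apply: vconv_coord => i; apply: hl.
exact: mem_enum.
Qed.

Lemma closed_vconv {n} (S : Vec n -> Prop) a l :
  closed S -> (forall k, S (a k)) -> vconv a l -> S l.
Proof.
move=> hS ha hl; apply: hS => eps /hl[N hN]; exists (a N); split=> //.
by rewrite vnorm_opp_sub; exact: hN.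
Qed.

(** Direct method. Boundedness is asked of one sublevel set only, because the intended [S] contains
    the possibly unbounded factor [C]. *)
Lemma exists_minimizer {n} (S : Vec n -> Prop) (f : Vec n -> R) z0 B :
  closed S -> S z0 -> (forall z, S z -> 0 <= f z) ->
  (forall z, S z -> f z <= f z0 -> vnorm z <= B) ->
  (forall z eps, S z -> 0 < eps -> exists d, 0 < d /\
     forall z', S z' -> vnorm (vsub z' z) < d -> f z <= f z' + eps) ->
  exists z, S z /\ forall z', S z' -> f z <= f z'.
Proof.
move=> hcl hz0 fge0 hB lsc.
have [||s [sub slub]] := completeness (fun t => exists z, S z /\ t = - f z).
- by exists 0 => _ [z [hz ->]]; move: (fge0 _ hz); lra.
- by exists (- f z0), z0.
(* The minimising sequence is kept below the value at [z0], falling back on [z0] itself, so that it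
   stays in the bounded sublevel set. *)
have /choice [a ha] k : exists z, S z /\ f z <= f z0 /\ f z < - s + / (INR k + 1).
  have k0 := inv_succ_gt0 k.
  have [z [hz fz]] : exists z, S z /\ f z < - s + / (INR k + 1).
    apply: NNPP => hn; suff: s <= s - / (INR k + 1) by lra.
    apply: slub => _ [z [hz ->]]; apply: Rnot_lt_le => h.
    by apply: hn; exists z; split=> //; lra.
  by case: (Rle_lt_dec (f z) (f z0)) => h; [exists z | exists z0]; do !split=> //; lra.
have [|phi [l [hphi hl]]] := bolzano_weierstrass a B.
  by move=> k; have [h1 [h2 _]] := ha k; exact: hB.
have Sl : S l by apply: (closed_vconv _ _ _ hcl) hl => k; case: (ha (phi k)).
exists l; split=> // z' hz'.
apply: le_of_le_eps => eps e0.
have [d [d0 hd]] := lsc l (eps / 2) Sl ltac:(lra).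
have [N1 h1] := hl _ d0; have [|N2 h2] := inv_succ_small (eps / 2); first lra.
set k := maxn N1 N2.
have [Sk [_ fk]] := ha (phi k).
have := hd _ Sk (h1 k (leq_maxl _ _)).
have := h2 (phi k) (leq_trans (leq_maxr _ _) (hphi k)).
have : - f z' <= s by apply: sub; exists z'.
lra.
Qed.

(** * Linear maps and their transposes *)

Section Linear.
Context {n l : nat} (L : Vec n -> Vec l).
Hypothesis linL : linear1 L.

Lemma linear1_add a b : L (vadd a b) = vadd (L a) (L b).
Proof.
have := linL 1 1 a b.
have -> : vadd (vscal 1 a) (vscal 1 b) = vadd a b by vring.
move=> ->; vring.
Qed.

Lemma linear1_scal t a : L (vscal t a) = vscal t (L a).
Proof.
have := linL t 0 a a.
have -> : vadd (vscal t a) (vscal 0 a) = vscal t a by vring.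
move=> ->; vring.
Qed.

Lemma linear1_0 : L vzero = vzero.
Proof.
have {1}-> : @vzero n = vscal 0 vzero by vring.
rewrite linear1_scal; vring.
Qed.

Lemma linear1_sub a b : L (vsub a b) = vsub (L a) (L b).
Proof.
have -> : vsub a b = vadd a (vscal (-1) b) by vring.
rewrite linear1_add linear1_scal; vring.
Qed.

Lemma linear1_basis a : L a = \big[vadd/vzero]_(j < n) vscal (a j) (L (ebasis j)).
Proof.
rewrite {1}(vec_basis a) (big_morph L linear1_add linear1_0).
by apply: eq_bigr => j _; rewrite linear1_scal.
Qed.

Lemma linear1_bound a : vnorm (L a) <= \big[Rplus/0]_(j < n) vnorm (L (ebasis j)) * vnorm a.
Proof.
rewrite linear1_basis Rmult_comm -sum_Rmult.
apply: (Rle_trans _ (\big[Rplus/0]_(j < n) vnorm (vscal (a j) (L (ebasis j))))).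
  elim/big_rec2: _ => [|j x y _ h]; first by rewrite vnorm0; lra.
  by apply: Rle_trans (vnorm_triangle _ _) _; lra.
apply: sum_Rle => j; rewrite vnorm_scal.
by apply: Rmult_le_compat_r; [exact: vnorm_ge0 | exact: coord_le_vnorm].
Qed.

Lemma dot_adj lam a : dot (adj L lam) a = dot lam (L a).
Proof.
rewrite [in RHS]linear1_basis.
rewrite (big_morph (dot lam) (dot_addr lam) (dot0r lam)).
by apply: eq_bigr => j _; rewrite dot_scalr /adj; ring.
Qed.
End Linear.

(** * Calculus near a point of twice differentiability *)

Section TwiceDifferentiable.
Context {n l : nat} (G : Vec n -> Vec l) (DG D2 : Vec n -> Vec n -> Vec l) (zb : Vec n) (r : R).
Hypothesis r_gt0 : 0 < r.
Hypothesis G_diff : forall z, vnorm (vsub z zb) < r -> frechet1 G (DG z) z.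
Hypothesis DG_diff : forall h, frechet1 (fun z => DG z h) (fun k => D2 k h) zb.

Lemma DG_linear z : vnorm (vsub z zb) < r -> linear1 (DG z).
Proof. by move/G_diff => []. Qed.

Lemma DG_linear_base : linear1 (DG zb).
Proof. by apply: DG_linear; rewrite vnorm_subxx. Qed.

Lemma D2_linear h : linear1 (D2^~ h).
Proof. by case: (DG_diff h). Qed.

(** Differentiability of [DG] is given for each fixed direction. The finitely many basis directions
    share a radius, and linearity of [DG z - DG zb] makes the estimate uniform in [h]. *)
Lemma DG_calm : exists C d, 0 <= C /\ 0 < d <= r /\ forall z, vnorm (vsub z zb) < d ->
  forall h, vnorm (vsub (DG z h) (DG zb h)) <= C * vnorm (vsub z zb) * vnorm h.
Proof.
have [|t [t0 ht]] := @fin_small n (fun j t => forall u, vnorm u < t ->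
   vnorm (vsub (vsub (DG (vadd zb u) (ebasis j)) (DG zb (ebasis j))) (D2 u (ebasis j)))
   <= 1 * vnorm u).
  move=> j; have [_ /(_ 1 Rlt_0_1)[d [d0 hd]]] := DG_diff (ebasis j).
  by exists d; split=> // t _ htd u hu; apply: hd; lra.
(* The sum bounds the linear map [D2] in direction [ebasis j]; the 1 pays for the remainder, taken
   with tolerance 1. *)
pose K j := 1 + \big[Rplus/0]_(i < n) vnorm (D2 (ebasis i) (ebasis j)).
exists (\big[Rplus/0]_(j < n) K j), (Rmin t r); split.
  apply: sum_Rge0 => j; suff: 0 <= \big[Rplus/0]_(i < n) vnorm (D2 (ebasis i) (ebasis j)).
    by rewrite /K; lra.
  by apply: sum_Rge0 => i; exact: vnorm_ge0.
split; first by split; [exact: Rmin_glb_lt | exact: Rmin_r].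
move=> z hz h.
have hzt : vnorm (vsub z zb) < t by apply: Rlt_le_trans hz (Rmin_l _ _).
have hzr : vnorm (vsub z zb) < r by apply: Rlt_le_trans hz (Rmin_r _ _).
have lin : linear1 (fun h => vsub (DG z h) (DG zb h)).
  move=> a b u v; rewrite (DG_linear _ hzr) DG_linear_base; vring.
apply: Rle_trans (linear1_bound _ lin h) _.
apply: Rmult_le_compat_r; first exact: vnorm_ge0.
rewrite Rmult_comm -sum_Rmult; apply: sum_Rle => j.
have := ht j _ hzt; set u := vsub z zb.
have -> : vadd zb u = z by rewrite /u; vring.
have := linear1_bound _ (D2_linear (ebasis j)) u.
have := vnorm_le_sub (vsub (DG z (ebasis j)) (DG zb (ebasis j))) (D2 u (ebasis j)).
by rewrite /K; set S := \big[_/_]_(_ < _) _; nra.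
Qed.

Lemma derivable_line mu z h t : vnorm (vsub (vadd z (vscal t h)) zb) < r ->
  derivable_pt_lim (fun t => dot mu (G (vadd z (vscal t h)))) t
    (dot mu (DG (vadd z (vscal t h)) h)).
Proof.
set zt := vadd z _ => hz eps e0.
have [lin hd] := G_diff _ hz.
have M0 : 0 <= vnorm mu * vnorm h by apply: Rmult_le_pos; exact: vnorm_ge0.
pose e := eps / (vnorm mu * vnorm h + 1).
have e'0 : 0 < e by apply: Rdiv_lt_0_compat; lra.
have [d [d0 {}hd]] := hd e e'0.
have h1 : 0 < d / (vnorm h + 1) by apply: Rdiv_lt_0_compat; move: (vnorm_ge0 h); lra.
exists (mkposreal _ h1) => s s0 /= hs.
have sabs := Rabs_pos_lt s s0.
have hsd : vnorm (vscal s h) < d.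
  rewrite vnorm_scal; apply: (Rle_lt_trans _ (Rabs s * (vnorm h + 1))); first by nra.
  move: (Rmult_lt_compat_r (vnorm h + 1) _ _ ltac:(move: (vnorm_ge0 h); lra) hs).
  have -> : d / (vnorm h + 1) * (vnorm h + 1) = d by field; move: (vnorm_ge0 h); lra.
  by [].
have := hd _ hsd.
have -> : vadd zt (vscal s h) = vadd z (vscal (t + s) h) by rewrite /zt; vring.
rewrite (linear1_scal _ lin) vnorm_scal => hdd.
set E := vsub (vsub _ _) _ in hdd.
have -> : (dot mu (G (vadd z (vscal (t + s) h))) - dot mu (G zt)) / s - dot mu (DG zt h)
   = dot mu E / s by rewrite /E !dotE; field.
rewrite /Rdiv Rabs_mult Rabs_inv.
have hE := cauchy_schwarz_abs mu E.
have hE2 : Rabs (dot mu E) <= (vnorm mu * vnorm h * e) * Rabs s.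
  by apply: Rle_trans hE _; move: (vnorm_ge0 mu); nra.
apply: (Rle_lt_trans _ (vnorm mu * vnorm h * e)).
  apply: (Rmult_le_reg_r (Rabs s)) => //.
  by rewrite Rmult_assoc Rinv_l; lra.
have -> : eps = (vnorm mu * vnorm h + 1) * e by rewrite /e; field; lra.
nra.
Qed.

Lemma segment_ball d a b t : 0 <= t <= 1 -> vnorm (vsub a zb) < d -> vnorm (vsub b zb) < d ->
  vnorm (vsub (vadd a (vscal t (vsub b a))) zb) < d.
Proof.
move=> ht ha hb.
have -> : vsub (vadd a (vscal t (vsub b a))) zb =
   vadd (vscal (1 - t) (vsub a zb)) (vscal t (vsub b zb)) by vring.
apply: Rle_lt_trans (vnorm_triangle _ _) _.
rewrite !vnorm_scal !Rabs_right; try lra.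
have [->|h0] : t = 0 \/ 0 < t by lra.
  lra.
by nra.
Qed.

Lemma mean_value mu a b : vnorm (vsub a zb) < r -> vnorm (vsub b zb) < r ->
  exists t, 0 < t < 1 /\
    dot mu (vsub (G b) (G a)) = dot mu (DG (vadd a (vscal t (vsub b a))) (vsub b a)).
Proof.
move=> ha hb.
have [t [ht t01]] := MVT_cor2 (fun t => dot mu (G (vadd a (vscal t (vsub b a)))))
  (fun t => dot mu (DG (vadd a (vscal t (vsub b a))) (vsub b a))) 0 1 Rlt_0_1
  (fun t ht => derivable_line mu a (vsub b a) t (segment_ball _ _ _ _ ht ha hb)).
exists t; split=> //; move: ht.
have -> : vadd a (vscal 1 (vsub b a)) = b by vring.
have -> : vadd a (vscal 0 (vsub b a)) = a by vring.
rewrite dotE; lra.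
Qed.

(** The mean value theorem is scalar, so it is tested with [mu] equal to the increment [G a - G b];
    dividing by its norm gives the vector estimate. *)
Lemma G_lipschitz : exists L d, 0 <= L /\ 0 < d <= r /\
  (forall z h, vnorm (vsub z zb) < d -> vnorm (DG z h) <= L * vnorm h) /\
  forall a b, vnorm (vsub a zb) < d -> vnorm (vsub b zb) < d ->
    vnorm (vsub (G a) (G b)) <= L * vnorm (vsub a b).
Proof.
have [C [d [C0 [[d0 dr] hC]]]] := DG_calm.
set S := \big[Rplus/0]_(j < n) vnorm (DG zb (ebasis j)).
have S0 : 0 <= S by apply: sum_Rge0 => j; exact: vnorm_ge0.
have hD z h : vnorm (vsub z zb) < d -> vnorm (DG z h) <= (C * d + S) * vnorm h.
  move=> hz; have := hC _ hz h; have := linear1_bound _ DG_linear_base h; rewrite -/S.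
  have := vnorm_le_sub (DG z h) (DG zb h).
  have : C * vnorm (vsub z zb) * vnorm h <= C * d * vnorm h.
    apply: Rmult_le_compat_r; first exact: vnorm_ge0.
    by apply: Rmult_le_compat_l => //; lra.
  lra.
exists (C * d + S), d; do !split=> //; first nra.
move=> a b ha hb; set D := vsub (G a) (G b).
have [t [t01 ht]] := mean_value D b a ltac:(lra) ltac:(lra).
have := hD _ (vsub a b) (segment_ball d b a t ltac:(lra) hb ha).
move: ht; rewrite -/D -vnorm_sq => ht.
have := cauchy_schwarz D (DG (vadd b (vscal t (vsub a b))) (vsub a b)).
rewrite -ht; move: (vnorm_ge0 D) => D0 h1 h2.
have [->|Dpos] : vnorm D = 0 \/ 0 < vnorm D by lra.
  by apply: Rmult_le_pos; [nra | exact: vnorm_ge0].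
apply: Rle_trans h2; exact: Rmult_le_reg_l h1.
Qed.

(* Second-order expansion along the perturbed directions [v' -> v]; the first-order
   term keeps [v'], while [v] suffices in the second-order one. *)
Lemma taylor2 mu v eps : 0 < eps -> exists d, 0 < d /\
  forall tau v', 0 < tau -> tau < d -> vnorm (vsub v' v) < d ->
    Rabs (dot mu (vsub (G (vadd zb (vscal tau v'))) (G zb)) - tau * dot mu (DG zb v')
          - / 2 * (tau * tau) * dot mu (D2 v v)) <= eps * (tau * tau).
Proof.
move=> e0.
have [C [d [C0 [[d0 dr] hC]]]] := DG_calm.
set S := \big[Rplus/0]_(j < n) vnorm (D2 (ebasis j) v).
have S0 : 0 <= S by apply: sum_Rge0 => j; exact: vnorm_ge0.
set V := vnorm v + 1; have V0 : 1 <= V by rewrite /V; move: (vnorm_ge0 v); lra.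
set M := vnorm mu + 1; have M0 : 1 <= M by rewrite /M; move: (vnorm_ge0 mu); lra.
set e1 := eps / (3 * M * V).
have MV : 1 <= M * V by nra.
have e10 : 0 < e1 by apply: Rdiv_lt_0_compat; nra.
have [_ /(_ e1 e10)[d1 [d10 hd1]]] := DG_diff v.
set e2 := eps / (3 * M * V * (C + S + 1)).
have e20 : 0 < e2 by apply: Rdiv_lt_0_compat => //; apply: Rmult_lt_0_compat; nra.
have e2E : M * (V * (C * e2)) + M * (S * e2) <= eps / 3.
  have -> : eps / 3 = M * V * (C + S + 1) * e2 by rewrite /e2; field; lra.
  have : 0 <= M * S * e2 * (V - 1).
    by apply: Rmult_le_pos; [apply: Rmult_le_pos; [apply: Rmult_le_pos|]|]; lra.
  have : 0 <= M * V * e2 by apply: Rmult_le_pos; lra.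
  by nra.
have e1E : M * (V * e1) = eps / 3 by rewrite /e1; field; lra.
set D := Rmin (Rmin (d / V) (d1 / V)) (Rmin e2 1).
have D0 : 0 < D by rewrite /D; do !apply: Rmin_glb_lt => //; try (apply: Rdiv_lt_0_compat; lra); lra.
exists D; split=> // tau v' t0 tD hv'.
have [tdV td1V] : tau < d / V /\ tau < d1 / V.
  by move: tD; rewrite /D => h; split; apply: Rlt_le_trans h _; apply: Rle_trans (Rmin_l _ _) _;
    [exact: Rmin_l | exact: Rmin_r].
have [hv2 hv1] : vnorm (vsub v' v) < e2 /\ vnorm (vsub v' v) < 1.
  by move: hv'; rewrite /D => h; split; apply: Rlt_le_trans h _; apply: Rle_trans (Rmin_r _ _) _;
    [exact: Rmin_l | exact: Rmin_r].
have v'V : vnorm v' <= V by rewrite /V; move: (vnorm_le_sub v' v); lra.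
have tV : tau * V < d.
  have -> : d = d / V * V by field; lra.
  by apply: Rmult_lt_compat_r; lra.
have tV1 : tau * V < d1.
  have -> : d1 = d1 / V * V by field; lra.
  by apply: Rmult_lt_compat_r; lra.
have line s : 0 <= s <= 1 -> vnorm (vscal s (vscal tau v')) <= tau * V.
  move=> hs; rewrite !vnorm_scal !Rabs_right; try lra.
  have : 0 <= tau * vnorm v' <= tau * V.
    by split; [apply: Rmult_le_pos; [lra|exact: vnorm_ge0] | apply: Rmult_le_compat_l; lra].
  by nra.
have lineb s : 0 <= s <= 1 -> vnorm (vsub (vadd zb (vscal s (vscal tau v'))) zb) <= tau * V.
  move=> /line; have -> // : vsub (vadd zb (vscal s (vscal tau v'))) zb = vscal s (vscal tau v').
  vring.
pose b := / 2 * (tau * tau) * dot mu (D2 v v).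
(* [f 1 - f 0] is the whole remainder. With the quadratic subtracted beforehand a single first-order
   mean value suffices, which matters because [DG] is assumed differentiable at [zb] alone. *)
pose f s := dot mu (G (vadd zb (vscal s (vscal tau v')))) - s * (tau * dot mu (DG zb v')) - s * s * b.
pose f' s := dot mu (DG (vadd zb (vscal s (vscal tau v'))) (vscal tau v'))
   - tau * dot mu (DG zb v') - 2 * s * b.
have hf s : 0 <= s <= 1 -> derivable_pt_lim f s (f' s).
  move=> hs; apply: derivable_pt_lim_minus; first apply: derivable_pt_lim_minus.
  - by apply: derivable_line; move: (lineb _ hs); lra.
  - have -> : tau * dot mu (DG zb v') = 1 * (tau * dot mu (DG zb v')) + s * 0 by ring.
    have -> : (fun s0 : R => s0 * (1 * (tau * dot mu (DG zb v')) + s * 0)) =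
       mult_fct id (fct_cte (tau * dot mu (DG zb v'))).
      by apply: functional_extensionality => x; rewrite /mult_fct /id /fct_cte; ring.
    apply: derivable_pt_lim_mult; [exact: derivable_pt_lim_id | exact: derivable_pt_lim_const].
  - have -> : 2 * s * b = (1 * s + s * 1) * b + s * s * 0 by ring.
    apply: (derivable_pt_lim_mult (mult_fct id id) (fct_cte b)); last exact: derivable_pt_lim_const.
    by apply: derivable_pt_lim_mult; exact: derivable_pt_lim_id.
have [s [hs s01]] := MVT_cor2 f f' 0 1 Rlt_0_1 hf.
have -> : dot mu (vsub (G (vadd zb (vscal tau v'))) (G zb)) - tau * dot mu (DG zb v')
          - / 2 * (tau * tau) * dot mu (D2 v v) = f' s.
  have -> : f' s = f 1 - f 0 by rewrite hs; ring.
  rewrite /f /b.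
  have -> : vadd zb (vscal 1 (vscal tau v')) = vadd zb (vscal tau v') by vring.
  have -> : vadd zb (vscal 0 (vscal tau v')) = zb by vring.
  by rewrite dotE; ring.
have hs' : 0 <= s <= 1 by lra.
set z := vadd zb (vscal s (vscal tau v')).
have hz : vnorm (vsub z zb) <= tau * V := lineb _ hs'.
have linz : linear1 (DG z) by apply: DG_linear; lra.
(* [E1] is the remainder of differentiating [DG] in the fixed direction [v], [E2] the cost of
   replacing [v'] by [v] as direction (small by calmness), [E3] the cost of replacing it as
   increment. *)
pose E1 := vsub (vsub (DG z v) (DG zb v)) (D2 (vscal s (vscal tau v')) v).
pose E2 := vsub (DG z (vsub v' v)) (DG zb (vsub v' v)).
pose E3 := D2 (vsub v' v) v.
have -> : f' s = tau * dot mu E1 + tau * dot mu E2 + s * (tau * tau) * dot mu E3.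
  rewrite /f' /b -/z /E1 /E2 /E3 !(linear1_scal _ linz) !(linear1_sub _ linz).
  rewrite (linear1_sub _ DG_linear_base).
  rewrite !(linear1_scal _ (D2_linear v)) (linear1_sub _ (D2_linear v)) !dotE.
  by field.
have h1 : Rabs (dot mu E1) <= tau * (M * (V * e1)).
  apply: Rle_trans (cauchy_schwarz_abs _ _) _.
  have hl := line _ hs'.
  have : vnorm E1 <= e1 * (tau * V).
    apply: (Rle_trans _ (e1 * vnorm (vscal s (vscal tau v')))); last by apply: Rmult_le_compat_l; lra.
    by apply: hd1; lra.
  have : vnorm mu <= M by rewrite /M; lra.
  move: (vnorm_ge0 mu) (vnorm_ge0 E1) => ? ? ? ?.
  have -> : tau * (M * (V * e1)) = M * (e1 * (tau * V)) by ring.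
  exact: Rmult_le_compat.
have h2 : Rabs (dot mu E2) <= tau * (M * (V * (C * e2))).
  apply: Rle_trans (cauchy_schwarz_abs _ _) _.
  have : vnorm E2 <= C * (tau * V) * e2.
    apply: Rle_trans (hC z ltac:(lra) _) _.
    have : 0 <= C * vnorm (vsub z zb) <= C * (tau * V).
      by split; [apply: Rmult_le_pos => //; exact: vnorm_ge0 | apply: Rmult_le_compat_l].
    move=> [h h']; apply: Rmult_le_compat => //; [exact: vnorm_ge0 | lra].
  have : vnorm mu <= M by rewrite /M; lra.
  move: (vnorm_ge0 mu) (vnorm_ge0 E2) => ? ? ? ?.
  have -> : tau * (M * (V * (C * e2))) = M * (C * (tau * V) * e2) by ring.
  exact: Rmult_le_compat.
have h3 : Rabs (dot mu E3) <= M * (S * e2).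
  apply: Rle_trans (cauchy_schwarz_abs _ _) _.
  have : vnorm E3 <= S * e2.
    apply: Rle_trans (linear1_bound _ (D2_linear v) _) _.
    by rewrite -/S; apply: Rmult_le_compat_l; lra.
  have : vnorm mu <= M by rewrite /M; lra.
  move: (vnorm_ge0 mu) (vnorm_ge0 E3) => ? ? ? ?.
  exact: Rmult_le_compat.
have tt : 0 < tau * tau by nra.
apply: Rle_trans (Rabs_triang _ _) _.
have : Rabs (s * (tau * tau) * dot mu E3) <= tau * tau * (M * (S * e2)).
  rewrite Rabs_mult (Rabs_right (s * (tau * tau))); last by nra.
  have : 0 <= s * (tau * tau) <= tau * tau by nra.
  move=> [? ?]; apply: Rmult_le_compat => //; exact: Rabs_pos.
move: (Rabs_triang (tau * dot mu E1) (tau * dot mu E2)).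
rewrite !(Rabs_mult tau) (Rabs_right tau); last by lra.
move: (Rmult_le_compat_l tau _ _ (Rlt_le _ _ t0) h1) (Rmult_le_compat_l tau _ _ (Rlt_le _ _ t0) h2).
nra.
Qed.
End TwiceDifferentiable.

(** * Extended reals, distances, and the two curvatures *)

Lemma ER_le_trans b a c : ER_le a b -> ER_le b c -> ER_le a c.
Proof. by case: a b c => [x||] [y||] [z||] //=; lra. Qed.

Lemma ER_le_or_lt a b : ER_le a b \/ ER_lt b a.
Proof.
case: a b => [x||] [y||] /=; try (by left); try (by right).
by case: (Rle_lt_dec x y) => h; [left | right; split=> /=; [lra | case; lra]].
Qed.

Lemma ER_lt_not_le a b : ER_lt a b -> ER_le b a -> False.
Proof. by case: a b => [x||] [y||] [] //= h hn h'; apply: hn; congr Fin; lra. Qed.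

Lemma ER_lt_Fin x y : ER_lt (Fin x) (Fin y) <-> x < y.
Proof.
split=> [[/= h hn]|h]; last by split=> /=; [lra | case; lra].
by case: (Req_dec x y) => [e|]; [case: hn; rewrite e | lra].
Qed.

Lemma ER_le_lt_trans b a c : ER_le a b -> ER_lt b c -> ER_lt a c.
Proof.
move=> h1 h2; case: (ER_le_or_lt c a) => // h3.
by case: (ER_lt_not_le _ _ h2); exact: ER_le_trans h3 h1.
Qed.

Lemma ER_lub_exists (E : ER -> Prop) : exists s, Defs.is_lub E s.
Proof.
case: (classic (exists M, forall x, E x -> ER_le x (Fin M))) => [[M hM]|hM]; last first.
  exists PInf; split=> [[]//|[b||] hb //=].
    by case: hM; exists b.
  by case: hM; exists 0 => x /hb; case: x.
case: (classic (exists r, E (Fin r))) => [[r hr]|hr]; last first.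
  exists MInf; split=> [[x||] //= hx|[]//]; first by case: hr; exists x.
  by case: (hM _ hx).
have [||s [sub slub]] := completeness (fun t => E (Fin t)).
- by exists M => x /hM.
- by exists r.
exists (Fin s); split=> [[x||] hx //=|[b||] hb //=].
- exact: sub.
- by case: (hM _ hx).
- by apply: slub => x /hb.
- by case: (hb _ hr).
Qed.

Lemma ER_sup_lub E : Defs.is_lub E (ER_sup E).
Proof. exact: (epsilon_spec _ (Defs.is_lub E) (ER_lub_exists E)). Qed.

Lemma ER_inf_glb E : is_glb E (ER_inf E).
Proof.
apply: (epsilon_spec _ (Defs.is_glb E)).
have [s [sub slub]] := ER_lub_exists (fun b => forall x, E x -> ER_le b x).
by exists s; split=> [x hx|b hb]; [apply: slub => b; exact | exact: sub].
Qed.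

Lemma vdist_le {n} x (S : Vec n -> Prop) z : S z -> ER_le (vdist x S) (Fin (vnorm (vsub x z))).
Proof. by move=> hz; apply: (proj1 (ER_inf_glb _)); exists z. Qed.

Lemma ER_inf_lt E b : ER_lt (ER_inf E) b -> exists x, E x /\ ER_lt x b.
Proof.
move=> h; apply: NNPP => hn; apply: (ER_lt_not_le _ _ h); apply: (proj2 (ER_inf_glb _)) => x hx.
by case: (ER_le_or_lt b x) => // hl; case: hn; exists x.
Qed.

Lemma vdist_lt {n} x (S : Vec n -> Prop) e : ER_lt (vdist x S) (Fin e) ->
  exists z, S z /\ vnorm (vsub x z) < e.
Proof. by move/ER_inf_lt => [_ [[z [hz ->]] /ER_lt_Fin h]]; exists z. Qed.

Lemma ER_scale_lt t a e : 0 < t -> ER_lt (ER_scale (/ t) a) (Fin e) -> ER_lt a (Fin (e * t)).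
Proof.
move=> t0; case: a => [x||].
- move=> /ER_lt_Fin h; apply/ER_lt_Fin.
  have -> : x = / t * x * t by field; lra.
  exact: Rmult_lt_compat_r.
- by case.
- by [].
Qed.

(** Every tail infimum is at most the lower limit 0, which yields good indices arbitrarily far out,
    though not all large ones. *)
Lemma liminf_vdist {n} (tau : nat -> R) (y : nat -> Vec n) (S : Vec n -> Prop) :
  (forall k, 0 < tau k) ->
  ER_liminf (fun k => ER_scale (/ tau k) (vdist (y k) S)) = Fin 0 ->
  forall e N, 0 < e -> exists k z, (N <= k)%nat /\ S z /\ vnorm (vsub (y k) z) < e * tau k.
Proof.
move=> t0 h e N e0.
set a := (fun k => _) in h.
have h1 : ER_le (ER_inf (fun y => exists k, (N <= k)%nat /\ y = a k)) (Fin 0).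
  by rewrite -h; apply: (proj1 (ER_sup_lub _)); exists N.
have [_ [[k [hk ->]] hlt]] := ER_inf_lt _ _ (ER_le_lt_trans _ _ _ h1 (proj2 (ER_lt_Fin 0 e) e0)).
have [z [hz hd]] := vdist_lt _ _ _ (ER_scale_lt _ _ _ (t0 k) hlt).
by exists k, z.
Qed.

(** The slack [e] is there because the distance to the solution set is an infimum that need not be
    attained. *)
Lemma robinson_stable_elim {m n l} (P : Vec m -> Prop) (h : Vec m -> Vec n -> Vec l)
    (K : Vec l -> Prop) pb xb :
  robinson_stable P h K pb xb ->
  exists kappa r, 0 <= kappa /\ 0 < r /\
    forall p x, P p -> vnorm (vsub p pb) < r -> vnorm (vsub x xb) < r ->
    forall y e, K y -> 0 < e ->
    exists z, K (h p z) /\ vnorm (vsub x z) < kappa * vnorm (vsub (h p x) y) + e.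
Proof.
move=> [kappa [r [k0 [r0 H]]]]; exists kappa, r; do !split=> //.
move=> p x hp hpr hxr y e hy e0.
apply: vdist_lt; apply: ER_le_lt_trans (H _ _ hp hpr hxr) _.
move: (vdist_le (h p x) K y hy); case: (vdist _ _) => [d||] //= hd.
by apply/ER_lt_Fin; nra.
Qed.

(** A bound against every [y] in [K] passes to the infimum. The point [yb] keeps [K] nonempty, which
    rules out an infinite distance to the solution set. *)
Lemma robinson_stable_intro {m n l} (P : Vec m -> Prop) (h : Vec m -> Vec n -> Vec l)
    (K : Vec l -> Prop) pb xb yb kappa r : 0 < kappa -> 0 < r -> K yb ->
  (forall p x y, P p -> vnorm (vsub p pb) < r -> vnorm (vsub x xb) < r -> K y ->
    exists z, K (h p z) /\ vnorm (vsub x z) <= kappa * vnorm (vsub (h p x) y)) ->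
  robinson_stable P h K pb xb.
Proof.
move=> k0 r0 hyb H; exists kappa, r; split; first lra; split=> // p x hp hpr hxr.
have hK y : K y -> ER_le (vdist x (fun xi => K (h p xi))) (Fin (kappa * vnorm (vsub (h p x) y))).
  move=> /(H _ _ _ hp hpr hxr)[z [hz hd]].
  by apply: ER_le_trans (vdist_le x (fun xi => K (h p xi)) z hz) _.
case: (vdist x _) hK => [a||] hK //=; last by case: (hK _ hyb).
have hd : ER_le (Fin (a / kappa)) (vdist (h p x) K).
  apply: (proj2 (ER_inf_glb _)) => _ [y [/hK /= hy ->]] /=.
  apply: (Rmult_le_reg_l kappa) => //.
  by have -> : kappa * (a / kappa) = a by field; lra.
move: hd; case: (vdist _ _) => [d||] //= hd.
have -> : a = kappa * (a / kappa) by field; lra.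
by apply: Rmult_le_compat_l; lra.
Qed.

Lemma ER_le_addr_inf a c E : (forall y, E y -> ER_le a (ER_addr c y)) -> ER_le a (ER_addr c (ER_inf E)).
Proof.
move=> h.
have : ER_le (ER_addr (- c) a) (ER_inf E).
  apply: (proj2 (ER_inf_glb _)) => y /h; case: a {h} => [a||]; case: y => [y||] //=; lra.
by case: a {h} => [a||]; case: (ER_inf E) => [y||] //=; lra.
Qed.

(** The two limits have independent parameters [e1] and [e2]; sampling at their minimum produces one
    [tau] whose quotients belong to both families at once. *)
Lemma chi_low_le_chi_up {n m} (O : Vec n -> Prop) lam z v (P : Vec m -> Prop) mu pb w c :
  (forall e, 0 < e -> exists tau v' w', 0 < tau < e /\
     vnorm (vsub v' v) < e /\ vnorm (vsub w' w) < e /\ P (vadd pb (vscal tau w')) /\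
     ER_lt (vdist lam (lim_normal O (vadd z (vscal tau v')))) (Fin e) /\
     dot lam (vsub v' v) / tau <= c + dot mu (vsub w' w) / tau + e) ->
  ER_le (chi_low O lam z v) (ER_addr c (chi_up P mu pb w)).
Proof.
move=> H; apply: (proj2 (ER_sup_lub _)) => _ [e1 [e10 ->]].
apply: ER_le_addr_inf => _ [e2 [e20 ->]].
set A := ER_inf _; set B := ER_sup _.
have H' eta : 0 < eta -> exists a b, ER_le A (Fin a) /\ ER_le (Fin b) B /\ a <= c + b + eta.
  move=> eta0; have [|tau [v' [w' [[t0 te] [hv [hw [hP [hd hle]]]]]]]] := H (Rmin (Rmin e1 e2) eta).
    by do !apply: Rmin_glb_lt.
  have le1 : Rmin (Rmin e1 e2) eta <= e1 by apply: Rle_trans (Rmin_l _ _) (Rmin_l _ _).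
  have le2 : Rmin (Rmin e1 e2) eta <= e2 by apply: Rle_trans (Rmin_l _ _) (Rmin_r _ _).
  have le3 : Rmin (Rmin e1 e2) eta <= eta by exact: Rmin_r.
  exists (dot lam (vsub v' v) / tau), (dot mu (vsub w' w) / tau); split.
    apply: (proj1 (ER_inf_glb _)); exists tau, v'; do 3 (split; first lra); split=> //.
    case: (ER_le_or_lt (Fin e1) (vdist lam (lim_normal O (vadd z (vscal tau v'))))) => // h.
    by case: (ER_lt_not_le _ _ hd); apply: ER_le_trans h.
  split; last lra.
  by apply: (proj1 (ER_sup_lub _)); exists tau, w'; do !split=> //; lra.
move: A B H' => A B H'.
have [a [b [ha [hb _]]]] := H' 1 Rlt_0_1.
(* The samples exclude [A = PInf] and [B = MInf], so only the case of two finite values needs the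
   vanishing error [eta]. *)
case: A B ha hb H' => [A||] [B||] //= _ _ H'.
apply: le_of_le_eps => eta /H'[a' [b' h]]; lra.
Qed.

Lemma closed_setprod {l1 l2} (C1 : Vec l1 -> Prop) (C2 : Vec l2 -> Prop) :
  closed C1 -> closed C2 -> closed (setprod C1 C2).
Proof.
move=> h1 h2 y hy; split; [apply: h1 | apply: h2] => eps /hy[z [[z1 z2] hz]].
- by exists (vfst z); split=> //; move: (vnorm_vfst (vsub y z)); rewrite pairE; lra.
- by exists (vsnd z); split=> //; move: (vnorm_vsnd (vsub y z)); rewrite pairE; lra.
Qed.

(** * Penalised minimisation and approximate multipliers *)

Section Weight.
Context {l1 l2 : nat} (a : R).
Hypothesis a_ge1 : 1 <= a.

(** Its norm is the penalty [sqrt (|y1|^2 + a^2 |y2|^2)]. Unlike [|y1| + a |y2|] it stays smooth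
    when only one block vanishes. *)
Definition weight (y : Vec (l1 + l2)) : Vec (l1 + l2) := vpack (vfst y) (vscal a (vsnd y)).

Lemma dot_weight y z : dot (weight y) (weight z) = dot (vfst y) (vfst z) + a * a * dot (vsnd y) (vsnd z).
Proof. by rewrite dot_pair !pairE !dotE; ring. Qed.

Lemma weight_add y z : weight (vadd y z) = vadd (weight y) (weight z).
Proof. apply: pair_ext; rewrite !pairE //; vring. Qed.

Lemma vnorm_weight_ge y : vnorm y <= vnorm (weight y).
Proof.
apply: vnorm_le_sq; first exact: vnorm_ge0.
have : 1 <= a * a by nra.
by rewrite vnorm_sq dot_weight dot_pair; move: (dot_ge0 (vsnd y)); nra.
Qed.

Lemma vnorm_weight_le y : vnorm (weight y) <= a * vnorm y.
Proof.
apply: vnorm_le_sq; first by move: (vnorm_ge0 y); nra.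
have -> : a * vnorm y * (a * vnorm y) = a * a * dot y y by rewrite -vnorm_sq; ring.
have : 1 <= a * a by nra.
by rewrite dot_weight (dot_pair y); move: (dot_ge0 (vfst y)); nra.
Qed.
End Weight.

(* Minimise [|weight (h x - y)| + c |x - x0|^2] over the ball times [C], with
   [c = 2 q0 / rho^2] where [q0] is the value at [(x0, y0)]: the minimiser is interior, and the
   objective is smooth there because [h x <> y].  The weight [a] exceeds the exact-penalty
   threshold given by the error bound for [C2], which keeps [vfst lam] away from zero. *)
Lemma approximate_multiplier {n l1 l2} (h : Vec n -> Vec (l1 + l2))
    (Dh : Vec n -> Vec n -> Vec (l1 + l2))
    (C1 : Vec l1 -> Prop) (C2 : Vec l2 -> Prop) L kappa x0 y0 rho a :
  0 <= L -> 0 <= kappa -> 0 < rho -> closed C1 -> closed C2 ->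
  a = (L + 1) * kappa + 1 ->
  (forall x, vnorm (vsub x x0) <= rho -> frechet1 h (Dh x) x) ->
  (forall x x', vnorm (vsub x x0) <= rho -> vnorm (vsub x' x0) <= rho ->
     vnorm (vsub (h x) (h x')) <= L * vnorm (vsub x x')) ->
  (forall x y, vnorm (vsub x x0) <= rho -> C2 y -> 0 < vnorm (vsub (vsnd (h x)) y) ->
     exists x', C2 (vsnd (h x')) /\ vnorm (vsub x x') <= kappa * vnorm (vsub (vsnd (h x)) y)) ->
  setprod C1 C2 y0 -> vnorm (vsub (h x0) y0) * (4 * a * (kappa + 1)) <= rho ->
  (forall x, vnorm (vsub x x0) <= rho -> ~ setprod C1 C2 (h x)) ->
  exists x y lam s1 s2,
    vnorm (vsub x x0) <= rho /\ setprod C1 C2 y /\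
    vnorm (vsub (h x) y) <= a * vnorm (vsub (h x0) y0) /\
    reg_normal (setprod C1 C2) y lam /\ vnorm lam <= a /\ / (1 + a) <= vnorm (vfst lam) /\
    (forall u, - (4 * a * (vnorm (vsub (h x0) y0) / rho) * vnorm u) <= dot lam (Dh x u)) /\
    0 <= s1 /\ 0 <= s2 /\ vsub (h x) y = vpack (vscal s1 (vfst lam)) (vscal s2 (vsnd lam)).
Proof.
move=> L0 k0 rho0 hC1 hC2 aE hdiff hlip hRS hy0 hsmall hne.
have La0 : 0 <= (L + 1) * kappa by nra.
have a1 : 1 <= a by lra.
set d0 := vnorm (vsub (h x0) y0) in hsmall *.
have d00 : 0 <= d0 := vnorm_ge0 _.
pose Q x y := vnorm (weight a (vsub (h x) y)).
set q0 := Q x0 y0.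
have q0d : q0 <= a * d0 by apply: vnorm_weight_le.
have x0b : vnorm (vsub x0 x0) <= rho by rewrite vnorm_subxx; lra.
have Qpos x y : vnorm (vsub x x0) <= rho -> setprod C1 C2 y -> 0 < Q x y.
  move=> hx hy; have := vnorm_weight_ge a a1 (vsub (h x) y).
  rewrite -/(Q x y); have [h0|] := Req_dec (vnorm (vsub (h x) y)) 0; last by move: (vnorm_ge0 (vsub (h x) y)); lra.
  case: (hne x hx); have -> // : h x = y.
  have -> : h x = vadd (vsub (h x) y) y by vring.
  rewrite (vnorm_eq0 _ h0); vring.
have q00 : 0 < q0 by exact: Qpos.
pose c := 2 * q0 / (rho * rho).
have rr : 0 < rho * rho by nra.
have c0 : 0 < c by apply: Rdiv_lt_0_compat; lra.
have cE : c * (rho * rho) = 2 * q0 by rewrite /c; field; lra.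
have cE1 : c * rho = 2 * q0 / rho by rewrite /c; field; lra.
have q0rho : 4 * q0 <= rho by nra.
clearbody c.
have QL x x' y y' : vnorm (vsub x x0) <= rho -> vnorm (vsub x' x0) <= rho ->
    Q x y <= Q x' y' + a * (L * vnorm (vsub x x') + vnorm (vsub y y')).
  move=> hx hx'; rewrite /Q.
  have -> : vsub (h x) y = vadd (vsub (h x') y') (vadd (vsub (h x) (h x')) (vsub y' y)) by vring.
  rewrite weight_add; apply: Rle_trans (vnorm_triangle _ _) _.
  apply: Rplus_le_compat_l; apply: Rle_trans (vnorm_weight_le a a1 _) _.
  apply: Rmult_le_compat_l; first lra.
  apply: Rle_trans (vnorm_triangle _ _) _.
  by move: (hlip _ _ hx hx'); rewrite (vnorm_opp_sub y' y); lra.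
have sqL x x' : vnorm (vsub x x0) <= rho -> vnorm (vsub x' x0) <= rho ->
    c * (vnorm (vsub x x0) * vnorm (vsub x x0)) <=
    c * (vnorm (vsub x' x0) * vnorm (vsub x' x0)) + 2 * (c * rho) * vnorm (vsub x x').
  move=> hx hx'; have := vnorm_sub_triangle x' x x0.
  move: (vnorm_ge0 (vsub x x0)) (vnorm_ge0 (vsub x' x0)) (vnorm_ge0 (vsub x x')).
  move: (vnorm (vsub x x0)) (vnorm (vsub x' x0)) (vnorm (vsub x x')) hx hx' => A B D hA hB A0 B0 D0 hABD.
  have : A * A <= B * B + 2 * rho * D by nra.
  by nra.
pose f (z : Vec (n + (l1 + l2))) :=
  Q (vfst z) (vsnd z) + c * (vnorm (vsub (vfst z) x0) * vnorm (vsub (vfst z) x0)).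
pose S (z : Vec (n + (l1 + l2))) := vnorm (vsub (vfst z) x0) <= rho /\ setprod C1 C2 (vsnd z).
have f0 : f (vpack x0 y0) = q0 by rewrite /f !pairE vnorm_subxx -/q0; ring.
have [|||z hz hzB|z eps Sz eps0|zt [[xb yC] hmin]] := @exists_minimizer _ S f (vpack x0 y0)
    (vnorm x0 + rho + (vnorm (h x0) + L * rho + q0)).
- move=> z hz; split.
    apply: le_of_le_eps => eps /hz[z' [[h1 _] h2]].
    move: (vnorm_vfst (vsub z z')) (vnorm_sub_triangle (vfst z') (vfst z) x0); rewrite pairE; lra.
  apply: closed_setprod => // eps /hz[z' [[_ h1] h2]].
  by exists (vsnd z'); split=> //; move: (vnorm_vsnd (vsub z z')); rewrite pairE; lra.
- by rewrite /S !pairE.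
- move=> z _; apply: Rplus_le_le_0_compat; first exact: vnorm_ge0.
  by apply: Rmult_le_pos; [lra | rewrite vnorm_sq; exact: dot_ge0].
- case: hz => hx hy; move: hzB; rewrite f0 /f => hf.
  have hQ : Q (vfst z) (vsnd z) <= q0.
    by move: hf; move: (vnorm_ge0 (vsub (vfst z) x0)); nra.
  have := vnorm_weight_ge a a1 (vsub (h (vfst z)) (vsnd z)); rewrite -/(Q _ _) => h1.
  have h2 := vnorm_le_sub (vsnd z) (h (vfst z)); rewrite vnorm_opp_sub in h2.
  have h3 := vnorm_le_sub (h (vfst z)) (h x0).
  have h4 := hlip _ _ hx x0b.
  have h5 := vnorm_le_sub (vfst z) x0.
  have h6 := vnorm_vpack_le (vfst z) (vsnd z); rewrite vpackE in h6.
  have : L * vnorm (vsub (vfst z) x0) <= L * rho by apply: Rmult_le_compat_l.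
  lra.
- set K := a * (L + 1) + 2 * (c * rho) + 1.
  have K0 : 0 < K by rewrite /K; nra.
  exists (eps / K); split; first exact: Rdiv_lt_0_compat.
  move=> z' [hx' _] hd; case: Sz => hx _.
  have := QL _ _ (vsnd z) (vsnd z') hx hx'; have := sqL _ _ hx hx'.
  move: (vnorm_vfst (vsub z z')) (vnorm_vsnd (vsub z z')); rewrite !pairE.
  have hd' : K * vnorm (vsub z z') <= eps.
    rewrite vnorm_opp_sub; have -> : eps = K * (eps / K) by field; lra.
    by apply: Rmult_le_compat_l; lra.
  rewrite /f; set D := vnorm (vsub z z') in hd' *.
  have D0 : 0 <= D by exact: vnorm_ge0.
  set D1 := vnorm (vsub (vfst z) _); set D2 := vnorm (vsub (vsnd z) _).
  move=> hD1 hD2 e1 e2.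
  have : L * D1 <= L * D by apply: Rmult_le_compat_l.
  move=> e3; have : a * (L * D1 + D2) <= a * (L * D + D) by apply: Rmult_le_compat_l; lra.
  have : c * rho * D1 <= c * rho * D by apply: Rmult_le_compat_l; nra.
  by move: hd'; rewrite /K; lra.
move: hmin xb yC; rewrite /f /S {f0 f S}; move: (vfst zt) (vsnd zt) => x y {zt}.
set r := vsub (h x) y; set q := Q x y; set D := vnorm (vsub x x0) => hmin xb yC.
have {}hmin x' y' : vnorm (vsub x' x0) <= rho -> setprod C1 C2 y' ->
    q + c * (D * D) <= Q x' y' + c * (vnorm (vsub x' x0) * vnorm (vsub x' x0)).
  by move=> hx' hy'; have := hmin (vpack x' y'); rewrite !pairE; apply.
have q_gt0 : 0 < q by exact: Qpos.
have D0 : 0 <= D by exact: vnorm_ge0.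
have hq0 : q + c * (D * D) <= q0.
  by have := hmin _ _ x0b hy0; rewrite vnorm_subxx -/q0; lra.
have DD : 0 <= c * (D * D) by nra.
(* [c * D^2 <= q0 = c * rho^2 / 2] gives [D <= rho / sqrt 2]. The remaining margin [rho / 4] is the
   room for the competitors below. *)
have D34 : D <= 3 / 4 * rho.
  apply: Rnot_lt_le => hD; have hDD : 9 / 16 * (rho * rho) <= D * D by nra.
  have : c * (9 / 16 * (rho * rho)) <= c * (D * D) by apply: Rmult_le_compat_l; lra.
  by lra.
have qE : q * q = dot (vfst r) (vfst r) + a * a * dot (vsnd r) (vsnd r).
  by rewrite /q /Q vnorm_sq dot_weight.
set r1 := vnorm (vfst r); set r2 := vnorm (vsnd r).
rewrite -!vnorm_sq -/r1 -/r2 in qE.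
have [r10 r20] : 0 <= r1 /\ 0 <= r2 by split; exact: vnorm_ge0.
(* Exact penalisation. The competitor moves to a solution [x'] of the second subsystem and takes
   [vsnd (h x')] as second block of [y]: that block of the residual vanishes, the first grows by at
   most [L * kappa * r2], the quadratic term by at most [kappa * r2]. Hence
   [q <= r1 + (a - 1) * r2], and squaring cancels [r1^2] and leaves [r2 <= r1]. *)
have r2r1 : r2 <= r1.
  have [->|r2pos] : r2 = 0 \/ 0 < r2 by lra.
    by [].
  have [x' [hx' xx']] := hRS x (vsnd y) xb (proj2 yC) r2pos.
  rewrite -/r2 in xx'.
  have r2q : a * r2 <= q by nra.
  have r2d : r2 <= d0 by nra.
  have kd : kappa * d0 <= rho / 4.
    have : d0 * (4 * (kappa + 1)) * 1 <= d0 * (4 * (kappa + 1)) * a.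
      by apply: Rmult_le_compat_l => //; nra.
    by nra.
  have x'b : vnorm (vsub x' x0) <= rho.
    have hkr : kappa * r2 <= kappa * d0 by apply: Rmult_le_compat_l.
    by have := vnorm_sub_triangle x x' x0; rewrite (vnorm_opp_sub x' x) -/D; lra.
  have y'C : setprod C1 C2 (vpack (vfst y) (vsnd (h x'))).
    by rewrite /setprod !pairE; split; [case: yC | ].
  have h0 := hmin _ _ x'b y'C.
  have QE : Q x' (vpack (vfst y) (vsnd (h x'))) = vnorm (vsub (vfst (h x')) (vfst y)).
    rewrite /Q /vnorm dot_weight !pairE.
    have -> : vsub (vsnd (h x')) (vsnd (h x')) = vzero by vring.
    by rewrite dot0l Rmult_0_r Rplus_0_r.
  rewrite QE in h0.
  have h1 : vnorm (vsub (vfst (h x')) (vfst y)) <= r1 + L * kappa * r2.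
    have := vnorm_sub_triangle (vfst (h x)) (vfst (h x')) (vfst y).
    have := vnorm_vfst (vsub (h x') (h x)); rewrite pairE.
    have := hlip _ _ x'b xb; rewrite (vnorm_opp_sub x' x).
    have : L * vnorm (vsub x x') <= L * (kappa * r2) by apply: Rmult_le_compat_l.
    by rewrite /r1 /r pairE; lra.
  have h2 := sqL x' x x'b xb; rewrite -/D (vnorm_opp_sub x' x) in h2.
  have h3 : 2 * (c * rho) * vnorm (vsub x x') <= kappa * r2.
    have : 2 * (c * rho) <= 1.
      rewrite cE1; apply: (Rmult_le_reg_r rho) => //.
      have -> : 2 * (2 * q0 / rho) * rho = 4 * q0 by field; lra.
      lra.
    have : 0 <= 2 * (c * rho) by nra.
    by move: (vnorm_ge0 (vsub x x')); nra.
  have h4 : q <= r1 + (a - 1) * r2 by rewrite aE; lra.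
  have : (2 * a - 1) * (r2 * r2) <= 2 * (a - 1) * (r1 * r2).
    have : q * q <= (r1 + (a - 1) * r2) * (r1 + (a - 1) * r2) by nra.
    by rewrite qE; lra.
  move=> h5; have h6 : (2 * a - 1) * r2 <= 2 * (a - 1) * r1.
    by apply: (Rmult_le_reg_r r2) => //; lra.
  apply: Rnot_lt_le => h7; nra.
have q_le : q <= a * d0 by lra.
have rE : r = vsub (h x) y by [].
clearbody r.
(* The gradient of the weighted norm at the residual [r]. *)
pose lam := vscal (/ q) (vpack (vfst r) (vscal (a * a) (vsnd r))).
have iq : 0 < / q by exact: Rinv_0_lt_compat.
have lamE s : q * dot lam s = dot (weight a r) (weight a s).
  rewrite dot_weight /lam dotE dot_pair !pairE !dotE; field; lra.
(* The square of the objective has an exact expansion, so the norm itself is never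
   differentiated. *)
have Qexp x' y' : Q x' y' * Q x' y' = q * q + 2 * (q * dot lam (vsub (vsub (h x') y') r))
    + vnorm (weight a (vsub (vsub (h x') y') r)) * vnorm (weight a (vsub (vsub (h x') y') r)).
  have qq : q * q = dot (weight a r) (weight a r) by rewrite rE -vnorm_sq.
  rewrite qq lamE /Q !vnorm_sq; set s := vsub (vsub _ _) r.
  have -> : vsub (h x') y' = vadd r s by rewrite /s; vring.
  by rewrite weight_add !dotE (dotC (weight a s)); ring.
have aa : 1 <= a * a by nra.
have lam_le : vnorm lam <= a.
  apply: vnorm_le_sq; first lra.
  apply: (Rmult_le_reg_l (q * q)); first nra.
  have -> : q * q * dot lam lam = r1 * r1 + a * a * (a * a) * (r2 * r2).
    rewrite /lam !dotE dot_pair !pairE !dotE -!vnorm_sq -/r1 -/r2. field; lra.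
  by rewrite qE; nra.
exists x, y, lam, q, (q / (a * a)); do 2 (split; first by []).
split; first exact: Rle_trans (vnorm_weight_ge a a1 _) q_le.
split.
  (* Optimality of [y] for fixed [x] gives the proximal inequality [2 * q * <lam, y' - y> <= a^2 *
     |y' - y|^2]; within this radius the right side is at most [2 * q * eps * |y' - y|]. *)
  split=> // eps eps0; exists (2 * q * eps / (a * a)); split.
    by apply: Rdiv_lt_0_compat; nra.
  move=> y' y'C hy'.
  have h1 := hmin _ _ xb y'C; rewrite -/D in h1.
  have := Qexp x y'.
  have -> : vsub (vsub (h x) y') r = vsub y y' by rewrite rE; vring.
  have h2 : q * q <= Q x y' * Q x y' by nra.
  have h3 := vnorm_weight_le a a1 (vsub y y'); rewrite (vnorm_opp_sub y y') in h3.
  have h4 := vnorm_ge0 (weight a (vsub y y')).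
  have h5 := vnorm_ge0 (vsub y' y).
  have -> : dot lam (vsub y y') = - dot lam (vsub y' y) by rewrite !dotE; ring.
  have h6 : a * a * vnorm (vsub y' y) <= 2 * q * eps.
    have -> : 2 * q * eps = a * a * (2 * q * eps / (a * a)) by field; lra.
    by apply: Rmult_le_compat_l; lra.
  set t := vnorm (vsub y' y) in h3 h5 h6 *.
  set w := vnorm (weight _ _) in h3 h4 *.
  move=> h7; have h8 : w * w <= a * a * t * t by nra.
  have h9 : a * a * t * t <= 2 * q * eps * t by apply: Rmult_le_compat_r.
  apply: (Rmult_le_reg_l (2 * q)); lra.
split; first by [].
have lam1 : vfst lam = vscal (/ q) (vfst r) by rewrite /lam !pairE.
have lam2 : vsnd lam = vscal (/ q * (a * a)) (vsnd r).
  rewrite /lam !pairE; vring.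
split.
  rewrite lam1 vnorm_scal Rabs_right -/r1; last lra.
  apply: (Rmult_le_reg_l (q * (1 + a))); first nra.
  have -> : q * (1 + a) * / (1 + a) = q by field; lra.
  have -> : q * (1 + a) * (/ q * r1) = (1 + a) * r1 by field; lra.
  have r22 : a * a * (r2 * r2) <= a * a * (r1 * r1) by apply: Rmult_le_compat_l; nra.
  have ar1 : 0 <= a * (r1 * r1) by nra.
  have q2 : q * q <= ((1 + a) * r1) * ((1 + a) * r1) by rewrite qE; lra.
  by apply: Rnot_lt_le => hlt; have : 0 <= (1 + a) * r1; nra.
split; last first.
  split; first lra.
  split; first by apply: Rlt_le; apply: Rdiv_lt_0_compat; lra.
  rewrite lam1 lam2 -rE -[LHS]vpackE; congr vpack; apply: functional_extensionality => i.
    by rewrite /vscal; field; lra.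
  by rewrite /vscal; field; lra.
move=> u; set U := vnorm u.
have U0 : 0 <= U := vnorm_ge0 u.
(* The directional derivative of the objective in [x]. The quadratic part is at most
   [2 * c * rho * |u| = 4 * (q0 / rho) * |u|], and [q0 <= a * d0]: this is the claimed stationarity
   error. *)
set A := dot lam (Dh x u) + 2 * c * dot (vsub x x0) u.
suff A0 : 0 <= A.
  have := cauchy_schwarz (vsub x x0) u; rewrite -/D -/U => h1.
  have : c * dot (vsub x x0) u <= c * rho * U.
    rewrite Rmult_assoc; apply: Rmult_le_compat_l; first lra.
    by apply: Rle_trans h1 _; apply: Rmult_le_compat_r.
  have : c * rho <= 2 * (a * (d0 / rho)).
    rewrite cE1; apply: (Rmult_le_reg_r rho) => //.
    have -> : 2 * q0 / rho * rho = 2 * q0 by field; lra.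
    have -> : 2 * (a * (d0 / rho)) * rho = 2 * (a * d0) by field; lra.
    lra.
  move=> h2 h3; have : c * rho * U <= 2 * (a * (d0 / rho)) * U by apply: Rmult_le_compat_r.
  by move: A0; rewrite /A; lra.
apply: le_of_le_eps => eta eta0.
have [lin hd] := hdiff x xb.
set e := eta / (2 * (a * U + 1)).
have aU : 0 <= a * U by nra.
have e0 : 0 < e by apply: Rdiv_lt_0_compat; lra.
have eE : a * e * U <= eta / 2.
  have -> : eta / 2 = e * (a * U + 1) by rewrite /e; field; lra.
  lra.
have [d [dpos {}hd]] := hd e e0.
(* Collects the terms quadratic in the step length [t]: one from the proximal term, one from the
   square in [Qexp]. *)
set B := c * (U * U) + a * a * (L * L) * (U * U) / (2 * q).
have B0 : 0 <= B.
  have : 0 <= a * a * (L * L) * (U * U) / (2 * q) by apply: Rle_mult_inv_pos; nra.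
  by rewrite /B; nra.
set T := Rmin (Rmin (d / (U + 1)) (rho / 4 / (U + 1))) (eta / 2 / (B + 1)).
have T0 : 0 < T by rewrite /T; do !apply: Rmin_glb_lt; apply: Rdiv_lt_0_compat; lra.
set t := T / 2.
have t0 : 0 < t by rewrite /t; lra.
have tT : t < T by rewrite /t; lra.
have td : t * U < d.
  have h1 : t < d / (U + 1) by apply: Rlt_le_trans tT _; apply: Rle_trans (Rmin_l _ _) (Rmin_l _ _).
  have -> : d = d / (U + 1) * (U + 1) by field; lra.
  by nra.
have trho : t * U <= rho / 4.
  have h1 : t < rho / 4 / (U + 1) by apply: Rlt_le_trans tT _; apply: Rle_trans (Rmin_l _ _) (Rmin_r _ _).
  have -> : rho / 4 = rho / 4 / (U + 1) * (U + 1) by field; lra.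
  by nra.
have tB : t * B <= eta / 2.
  have h1 : t < eta / 2 / (B + 1) by apply: Rlt_le_trans tT (Rmin_r _ _).
  have -> : eta / 2 = eta / 2 / (B + 1) * (B + 1) by field; lra.
  by nra.
have tuE : vnorm (vscal t u) = t * U by rewrite vnorm_scal Rabs_right -/U; lra.
have x'b : vnorm (vsub (vadd x (vscal t u)) x0) <= rho.
  have -> : vsub (vadd x (vscal t u)) x0 = vadd (vsub x x0) (vscal t u) by vring.
  by apply: Rle_trans (vnorm_triangle _ _) _; rewrite tuE -/D; lra.
have := hd (vscal t u); rewrite tuE (linear1_scal _ lin) => /(_ td) hE.
have hm := hmin _ _ x'b yC.
rewrite [vnorm (vsub (vadd x _) x0) * _]vnorm_sq in hm.
have DE : dot (vsub (vadd x (vscal t u)) x0) (vsub (vadd x (vscal t u)) x0)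
   = D * D + 2 * t * dot (vsub x x0) u + t * t * (U * U).
  have -> : vsub (vadd x (vscal t u)) x0 = vadd (vsub x x0) (vscal t u) by vring.
  have := vnorm_sq (vsub x x0); have := vnorm_sq u; rewrite -/D -/U.
  by move: (vsub x x0) => s; rewrite !dotE (dotC u) => <- <-; ring.
rewrite DE in hm.
have hQ := Qexp (vadd x (vscal t u)) y.
set Dlt := vsub (h (vadd x (vscal t u))) (h x) in hE.
have DltE : vsub (vsub (h (vadd x (vscal t u))) y) r = Dlt by rewrite /Dlt rE; vring.
rewrite DltE in hQ.
have hw : vnorm (weight a Dlt) <= a * (L * (t * U)).
  apply: Rle_trans (vnorm_weight_le a a1 _) _; apply: Rmult_le_compat_l; first lra.
  have := hlip _ _ x'b xb.
  have -> : vsub (vadd x (vscal t u)) x = vscal t u by vring.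
  by rewrite tuE.
have hww : vnorm (weight a Dlt) * vnorm (weight a Dlt) <= (a * (L * (t * U))) * (a * (L * (t * U))).
  by apply: Rmult_le_compat => //; exact: vnorm_ge0.
have hlam : dot lam Dlt <= t * dot lam (Dh x u) + t * (a * e * U).
  have := cauchy_schwarz lam (vsub Dlt (vscal t (Dh x u))); rewrite !dotE; move: lam_le.
  move: (vnorm_ge0 lam) (vnorm_ge0 (vsub Dlt (vscal t (Dh x u)))) => g1 g2 g3.
  have := Rmult_le_compat _ _ _ _ g1 g2 g3 hE.
  lra.
set X := Q _ y in hm hQ.
set W := vnorm _ * vnorm _ in hQ hww.
(* The square root lies below its tangent at [q^2]; this converts the expansion of [X^2] into an
   upper bound for [X]. *)
have sq : 2 * (q * X) <= X * X + q * q by move: (Rle_0_sqr (X - q)); rewrite /Rsqr; lra.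
have : 0 <= 2 * q * (t * (A + a * e * U + t * B)).
  have -> : 2 * q * (t * (A + a * e * U + t * B)) =
     2 * q * (t * dot lam (Dh x u) + t * (a * e * U)) + 2 * q * (c * (2 * t * dot (vsub x x0) u + t * t * (U * U)))
      + a * (L * (t * U)) * (a * (L * (t * U))).
    by rewrite /A /B; field; lra.
  have : q * dot lam Dlt <= q * (t * dot lam (Dh x u) + t * (a * e * U)).
    by apply: Rmult_le_compat_l; lra.
  have : q * (q + c * (D * D)) <= q * (X + c * (D * D + 2 * t * dot (vsub x x0) u + t * t * (U * U))).
    by apply: Rmult_le_compat_l; lra.
  lra.
move=> h1; have : 0 <= A + a * e * U + t * B.
  have qt : 0 < 2 * q * t by nra.
  by apply: (Rmult_le_reg_l (2 * q * t)) => //; lra.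
lra.
Qed.

Lemma vnorm_vpack0 {m n} (u : Vec n) : vnorm (vpack (@vzero m) u) = vnorm u.
Proof. by rewrite /vnorm dot_pair !pairE dot0l Rplus_0_l. Qed.

Lemma lim_normal_of_reg {n} (O : Vec n -> Prop) z v : reg_normal O z v -> lim_normal O z v.
Proof.
move=> h; split; first by case: h.
exists (fun _ => z), (fun _ => v); split; first by move=> e e0; exists 0%nat => k _; rewrite vnorm_subxx.
split; first by move=> e e0; exists 0%nat => k _; rewrite vnorm_subxx.
by move=> _; split=> //; case: h.
Qed.

(** Transfers the sign of the residual from approximate multipliers to their limit: a nonzero [mu]
    makes an acute angle with all vectors near it, and a zero [mu] is harmless. *)
Lemma dot_ge0_near {n} (mu : Vec n) : exists e, 0 < e /\
  forall nu, vnorm (vsub nu mu) < e -> 0 <= dot mu nu.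
Proof.
have [h|h] : vnorm mu = 0 \/ 0 < vnorm mu by move: (vnorm_ge0 mu); lra.
  exists 1; split; first lra.
  by move=> nu _; rewrite (vnorm_eq0 _ h) dot0l; lra.
exists (vnorm mu); split=> // nu hnu.
have -> : nu = vadd mu (vsub nu mu) by vring.
have := cauchy_schwarz_abs mu (vsub nu mu); rewrite dot_addr -vnorm_sq.
by rewrite /Rabs; case: Rcase_abs; nra.
Qed.

(** * Multipliers along a direction and directional solvability *)

Section System.
Context {m n l1 l2 : nat} (P : Vec m -> Prop) (pb : Vec m) (xb : Vec n).
Context (C1 : Vec l1 -> Prop) (C2 : Vec l2 -> Prop).
Context (G : Vec (m + n) -> Vec (l1 + l2)) (DG D2 : Vec (m + n) -> Vec (m + n) -> Vec (l1 + l2)).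
Context (r : R).
Let C := setprod C1 C2.
Let zb := vpack pb xb.
Hypothesis r_gt0 : 0 < r.
Hypothesis C1_closed : closed C1.
Hypothesis C2_closed : closed C2.
Hypothesis G_diff : forall z, vnorm (vsub z zb) < r -> frechet1 G (DG z) z.
Hypothesis DG_diff : forall h, frechet1 (fun z => DG z h) (fun k => D2 k h) zb.
Hypothesis zb_feasible : C (G zb).
Hypothesis stable2 : robinson_stable P (fun p x => vsnd (G (vpack p x))) C2 pb xb.

Lemma vsub_vpack_le (p p' : Vec m) (x x' : Vec n) :
  vnorm (vsub (vpack p x) (vpack p' x')) <= vnorm (vsub p p') + vnorm (vsub x x').
Proof.
have -> : vsub (vpack p x) (vpack p' x') = vpack (vsub p p') (vsub x x').
  by apply: pair_ext; rewrite !pairE.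
exact: vnorm_vpack_le.
Qed.

(** The point is uniformity: [a] and [c0] come from the Lipschitz constant of [G] near [zb] and the
    modulus of the second subsystem alone, so the bounds on [lam] survive a limit. *)
Lemma infeasible_multiplier : exists a c0 r0, 1 <= a /\ 0 < c0 /\ 0 < r0 /\
  forall p x y rho, P p -> vnorm (vsub p pb) < r0 -> vnorm (vsub x xb) < r0 ->
    0 < rho < r0 -> C y -> vnorm (vsub (G (vpack p x)) y) <= c0 * rho ->
    (forall x', vnorm (vsub x' x) <= rho -> ~ C (G (vpack p x'))) ->
  exists x' y' lam s1 s2,
    vnorm (vsub x' x) <= rho /\ C y' /\
    vnorm (vsub (G (vpack p x')) y') <= a * vnorm (vsub (G (vpack p x)) y) /\
    reg_normal C y' lam /\ vnorm lam <= a /\ / (1 + a) <= vnorm (vfst lam) /\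
    (forall u, - (4 * a * (vnorm (vsub (G (vpack p x)) y) / rho) * vnorm u)
       <= dot lam (DG (vpack p x') (vpack vzero u))) /\
    0 <= s1 /\ 0 <= s2 /\
    vsub (G (vpack p x')) y' = vpack (vscal s1 (vfst lam)) (vscal s2 (vsnd lam)).
Proof.
have [L [d [L0 [[d0 dr] [_ hL]]]]] := G_lipschitz _ _ _ _ _ r_gt0 G_diff DG_diff.
have [k [rR [k0 [rR0 hR]]]] := robinson_stable_elim _ _ _ _ _ stable2.
(* The error bound is applied with slack equal to the residual itself, so the modulus [k] becomes
   [k + 1]. *)
set a := (L + 1) * (k + 1) + 1.
have a1 : 1 <= a by rewrite /a; nra.
set K := 4 * a * (k + 1 + 1).
have K0 : 0 < K by rewrite /K; nra.
(* With [p], [x] and [rho] all within a quarter, every point [(p, x')] of the ball stays within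
   three quarters of [d] from [zb]. *)
exists a, (/ K), (Rmin d rR / 4); split=> //; split; first exact: Rinv_0_lt_compat.
have dd := Rmin_l d rR; have dR := Rmin_r d rR.
split; first by have := Rmin_glb_lt _ _ _ d0 rR0; lra.
move=> p x y rho hp hpr hxr [rho0 hrho] hy hsm hne.
have ball x' : vnorm (vsub x' x) <= rho -> vnorm (vsub (vpack p x') zb) < d.
  move=> hx'; have := vsub_vpack_le p pb x' xb; have := vnorm_sub_triangle x x' xb.
  by rewrite /zb; lra.
apply: (approximate_multiplier (fun x => G (vpack p x))
  (fun x u => DG (vpack p x) (vpack vzero u)) C1 C2 L (k + 1)) => //; first lra.
- move=> x' /ball hx'; have [|lin hd] := G_diff (vpack p x'); first lra.
  split=> [s t u v|eps /hd[e [e0 {}hd]]].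
    rewrite -lin; congr DG; apply: pair_ext; rewrite !pairE //; vring.
  exists e; split=> // u; rewrite -(@vnorm_vpack0 m) => /hd.
  have -> // : vadd (vpack p x') (vpack vzero u) = vpack p (vadd x' u).
  apply: pair_ext; rewrite !pairE //; vring.
- move=> x1 x2 /ball h1 /ball h2; apply: Rle_trans (hL _ _ h1 h2) _.
  apply: Rmult_le_compat_l => //.
  by have := vsub_vpack_le p p x1 x2; rewrite vnorm_subxx; lra.
- move=> x' y2 hx' hy2 hpos.
  have [|z [hz hxz]] := hR p x' hp ltac:(lra) _ y2 _ hy2 hpos.
    by have := vnorm_sub_triangle x x' xb; lra.
  by exists z; split=> //; lra.
- rewrite -/K; apply: (Rle_trans _ (/ K * rho * K)); first by apply: Rmult_le_compat_r; lra.
  by apply: Req_le; field; lra.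
Qed.

(** Moving from [x] to the near-minimiser costs at most [rho], which is o(tau), so the direction is
    still [v] in the limit. The stationarity error is proportional to residual over [rho], which is
    why the residual must be o(rho). *)
Lemma approximate_directional_multiplier v :
  (forall eps, 0 < eps -> exists tau p x y rho, P p /\ 0 < tau < eps /\
     vnorm (vsub p (vadd pb (vscal tau (vfst v)))) <= eps * tau /\
     vnorm (vsub x (vadd xb (vscal tau (vsnd v)))) <= eps * tau /\
     C y /\ 0 < rho <= eps * tau /\ vnorm (vsub (G (vpack p x)) y) <= eps * rho /\
     forall x', vnorm (vsub x' x) <= rho -> ~ C (G (vpack p x'))) ->
  exists a, 1 <= a /\ forall eta, 0 < eta -> exists tau v' y lam, 0 < tau < eta /\
    vnorm (vsub v' v) < eta /\ P (vadd pb (vscal tau (vfst v'))) /\ C y /\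
    vnorm (vsub (G (vadd zb (vscal tau v'))) y) <= eta * tau /\
    reg_normal C y lam /\ vnorm lam <= a /\ / (1 + a) <= vnorm (vfst lam) /\
    (forall u, - (eta * vnorm u) <= dot lam (DG (vadd zb (vscal tau v')) (vpack vzero u))) /\
    exists s1 s2, 0 <= s1 /\ 0 <= s2 /\
      vsub (G (vadd zb (vscal tau v'))) y = vpack (vscal s1 (vfst lam)) (vscal s2 (vsnd lam)).
Proof.
move=> H; have [a [c0 [r0 [a1 [c00 [r00 hm]]]]]] := infeasible_multiplier.
exists a; split=> // eta eta0.
have v0 := vnorm_ge0 v.
set eps := Rmin (Rmin 1 c0) (Rmin (eta / (4 * a)) (r0 / (vnorm v + 2))).
have eps0 : 0 < eps.
  by rewrite /eps; do !apply: Rmin_glb_lt => //; try (apply: Rdiv_lt_0_compat; lra); lra.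
have eps1 : eps <= 1 by apply: Rle_trans (Rmin_l _ _) (Rmin_l _ _).
have epsc : eps <= c0 by apply: Rle_trans (Rmin_l _ _) (Rmin_r _ _).
have epse : 4 * a * eps <= eta.
  have h : eps <= eta / (4 * a) by apply: Rle_trans (Rmin_r _ _) (Rmin_l _ _).
  have -> : eta = 4 * a * (eta / (4 * a)) by field; lra.
  by apply: Rmult_le_compat_l; lra.
have epsr : (vnorm v + 2) * eps <= r0.
  have h : eps <= r0 / (vnorm v + 2) by apply: Rle_trans (Rmin_r _ _) (Rmin_r _ _).
  have -> : r0 = (vnorm v + 2) * (r0 / (vnorm v + 2)) by field; lra.
  by apply: Rmult_le_compat_l; lra.
have [tau [p [x [y0 [rho [hp [[t0 te] [hpt [hxt [hy0 [[rho0 hrho] [hsm hne]]]]]]]]]]]] := H _ eps0.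
clearbody eps.
have tet : eps * tau <= eps by nra.
have near k (b z : Vec k) (w : Vec k) : vnorm w <= vnorm v ->
    vnorm (vsub z (vadd b (vscal tau w))) <= eps * tau -> vnorm (vsub z b) < r0.
  move=> hw hz.
  have -> : vsub z b = vadd (vsub z (vadd b (vscal tau w))) (vscal tau w) by vring.
  apply: Rle_lt_trans (vnorm_triangle _ _) _; rewrite vnorm_scal Rabs_right; last lra.
  have : tau * vnorm w <= eps * vnorm v by apply: Rmult_le_compat; try lra; exact: vnorm_ge0.
  nra.
have hpr := near _ _ _ _ (vnorm_vfst v) hpt.
have hxr := near _ _ _ _ (vnorm_vsnd v) hxt.
have sm : vnorm (vsub (G (vpack p x)) y0) <= c0 * rho by nra.
have rhor : rho < r0 by nra.
have [x' [y [lam [s1 [s2 [hx' [hy [hGy [hreg [hla [hl1 [hst [hs1 [hs2 hs]]]]]]]]]]]]]] :=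
  hm p x y0 rho hp hpr hxr (conj rho0 rhor) hy0 sm hne.
pose v' := vpack (vscal (/ tau) (vsub p pb)) (vscal (/ tau) (vsub x' xb)).
have cancel k (b z : Vec k) : vadd b (vscal tau (vscal (/ tau) (vsub z b))) = z.
  by apply: functional_extensionality => i; rewrite /vadd /vscal /vsub; field; lra.
have zE : vadd zb (vscal tau v') = vpack p x'.
  by apply: pair_ext; rewrite !pairE cancel.
have dirE k (b z w : Vec k) : vsub (vscal (/ tau) (vsub z b)) w
    = vscal (/ tau) (vsub z (vadd b (vscal tau w))).
  by apply: functional_extensionality => i; rewrite /vadd /vscal /vsub; field; lra.
have it : 0 < / tau by exact: Rinv_0_lt_compat.
exists tau, v', y, lam; rewrite zE; split; first by split=> //; nra.
split.
  rewrite -(vpackE v); apply: Rle_lt_trans (vsub_vpack_le _ _ _ _) _.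
  rewrite !dirE !vnorm_scal !Rabs_right; try lra.
  have h1 : vnorm (vsub x' (vadd xb (vscal tau (vsnd v)))) <= 2 * eps * tau.
    by have := vnorm_sub_triangle x x' (vadd xb (vscal tau (vsnd v))); lra.
  apply: (Rle_lt_trans _ (3 * eps)); last nra.
  apply: (Rmult_le_reg_l tau) => //.
  rewrite Rmult_plus_distr_l -!Rmult_assoc Rinv_r; lra.
split; first by rewrite pairE cancel.
have bound : a * vnorm (vsub (G (vpack p x)) y0) <= a * (eps * rho) by apply: Rmult_le_compat_l; lra.
split=> //; split.
  have : eps * rho <= eps * tau by nra.
  by move=> h; have : a * (eps * rho) <= a * (eps * tau); [apply: Rmult_le_compat_l; lra | nra].
split=> //; split=> //; split=> //; split; last by exists s1, s2.
move=> u; apply: Rle_trans (hst u); apply: Ropp_le_contravar.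
apply: Rmult_le_compat_r; first exact: vnorm_ge0.
apply: Rle_trans epse; apply: Rmult_le_compat_l; first lra.
apply: (Rmult_le_reg_r rho) => //.
by rewrite /Rdiv Rmult_assoc Rinv_l; lra.
Qed.

Hypothesis second_order : forall v lam, v <> vzero -> tangent P pb (vfst v) ->
  tangent C (G zb) (DG zb v) -> dir_normal C (G zb) (DG zb v) lam ->
  (forall u, dot lam (DG zb (vpack vzero u)) = 0) ->
  ER_le (chi_low C lam (G zb) (DG zb v))
    (ER_addr (1 / 2 * dot lam (D2 v v))
      (chi_up P (adj (fun w => DG zb (vpack w vzero)) lam) pb (vfst v))) ->
  vfst lam = vzero.

(** A single [eps] measures the scale, the deviation from the direction, the relative radius and the
    relative residual, so its failure for every [eps] is a sequence along which all of them
    vanish. *)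
Lemma directional_solvability v : v <> vzero -> exists eps, 0 < eps /\
  forall tau p x y rho, P p -> 0 < tau < eps ->
    vnorm (vsub p (vadd pb (vscal tau (vfst v)))) <= eps * tau ->
    vnorm (vsub x (vadd xb (vscal tau (vsnd v)))) <= eps * tau ->
    C y -> 0 < rho <= eps * tau -> vnorm (vsub (G (vpack p x)) y) <= eps * rho ->
    exists x', vnorm (vsub x' x) <= rho /\ C (G (vpack p x')).
Proof.
move=> v_neq0; apply: NNPP => hno.
have [eps eps0|a [a1 happ]] := approximate_directional_multiplier v.
  apply: NNPP => hno2; apply: hno; exists eps; split=> // tau p x y rho hp ht hpt hxt hy hrho hsm.
  apply: NNPP => hno3; apply: hno2; exists tau, p, x, y, rho; do 7 (split => //).
  by move=> x' hx' hC; apply: hno3; exists x'.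
have {happ} := fun k => happ _ (inv_succ_gt0 k).
move=> /choice[tau0] /choice[v0] /choice[y0] /choice[lam0] H0.
have [|phi [lam [hphi hlam]]] := bolzano_weierstrass lam0 a.
  by move=> k; have [_ [_ [_ [_ [_ [_ [h _]]]]]]] := H0 k.
pose tau k := tau0 (phi k); pose vk k := v0 (phi k).
pose y k := y0 (phi k); pose lamk k := lam0 (phi k).
pose z k := vadd zb (vscal (tau k) (vk k)).
have hP k : P (vadd pb (vscal (tau k) (vfst (vk k)))) by have [_ [_ [h _]]] := H0 (phi k).
have hC k : C (y k) by have [_ [_ [_ [h _]]]] := H0 (phi k).
have hreg k : reg_normal C (y k) (lamk k) by have [_ [_ [_ [_ [_ [h _]]]]]] := H0 (phi k).
have lam_le k : vnorm (lamk k) <= a by have [_ [_ [_ [_ [_ [_ [h _]]]]]]] := H0 (phi k).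
have lam1_ge k : / (1 + a) <= vnorm (vfst (lamk k)).
  by have [_ [_ [_ [_ [_ [_ [_ [h _]]]]]]]] := H0 (phi k).
have tau_gt0 k : 0 < tau k by have [[h _] _] := H0 (phi k).
have hsgn k : exists s1 s2, 0 <= s1 /\ 0 <= s2 /\
    vsub (G (z k)) (y k) = vpack (vscal s1 (vfst (lamk k))) (vscal s2 (vsnd (lamk k))).
  by have [_ [_ [_ [_ [_ [_ [_ [_ [_ h]]]]]]]]] := H0 (phi k).
have ev eta : 0 < eta -> exists N, forall k, (N <= k)%nat ->
    tau k < eta /\ vnorm (vsub (vk k) v) < eta /\ vnorm (vsub (lamk k) lam) < eta /\
    vnorm (vsub (G (z k)) (y k)) <= eta * tau k /\
    forall u, - (eta * vnorm u) <= dot (lamk k) (DG (z k) (vpack vzero u)).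
  move=> eta0; have [N1 h1] := inv_succ_small _ eta0; have [N2 h2] := hlam _ eta0.
  exists (maxn N1 N2) => k hk.
  have hke : / (INR (phi k) + 1) < eta.
    by apply: h1; apply: leq_trans (hphi k); apply: leq_trans hk; exact: leq_maxl.
  have [[_ g1] [g2 [_ [_ [g3 [_ [_ [_ [g4 _]]]]]]]]] := H0 (phi k).
  have t0 := tau_gt0 k.
  split; first by rewrite /tau; lra.
  split; first by rewrite /vk; lra.
  split; first by apply: h2; apply: leq_trans hk; exact: leq_maxr.
  split; first by apply: Rle_trans g3 _; apply: Rmult_le_compat_r; rewrite -/(tau k); lra.
  move=> u; apply: Rle_trans (g4 u); apply: Ropp_le_contravar.
  by apply: Rmult_le_compat_r; [exact: vnorm_ge0 | lra].
move: tau vk y lamk @z hP hC hreg lam_le lam1_ge tau_gt0 hsgn ev.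
move=> tau vk y lamk z hP hC hreg lam_le lam1_ge tau_gt0 hsgn ev {hlam hphi H0 hno phi tau0 v0 y0 lam0}.
have itau k : 0 < / tau k by exact: Rinv_0_lt_compat.
have tau_down : downto0 tau by split=> // eps /ev[N hN]; exists N => k /hN [].
have vk_conv : vconv vk v by move=> eps /ev[N hN]; exists N => k /hN [_ []].
have lamk_conv : vconv lamk lam by move=> eps /ev[N hN]; exists N => k /hN [_ [_ []]].
have linb := DG_linear_base _ _ _ _ r_gt0 G_diff.
set S := \big[Rplus/0]_(j < m + n) vnorm (DG zb (ebasis j)).
have S0 : 0 <= S by apply: sum_Rge0 => j; exact: vnorm_ge0.
(* Difference quotients of the points of [C]. They tend to [DG zb v] because the residual is o(tau),
   and then witness both the tangent direction and the directional normal. *)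
pose dy k := vscal (/ tau k) (vsub (y k) (G zb)).
have yE k : vadd (G zb) (vscal (tau k) (dy k)) = y k.
  apply: functional_extensionality => i; rewrite /dy /vadd /vscal /vsub; field.
  by move: (tau_gt0 k); lra.
have zE k : vsub (z k) zb = vscal (tau k) (vk k) by rewrite /z; vring.
have dy_conv : vconv dy (DG zb v).
  move=> eps eps0; have nv := vnorm_ge0 v.
  have [|_ /(_ (eps / (4 * (vnorm v + 1))))[|d [d0 hd]]] := G_diff zb.
  - by rewrite vnorm_subxx.
  - by apply: Rdiv_lt_0_compat; lra.
  set eta := Rmin (Rmin 1 (eps / 4)) (Rmin (d / (vnorm v + 1)) (eps / (4 * (S + 1)))).
  have eta0 : 0 < eta.
    by rewrite /eta; do !apply: Rmin_glb_lt; try (apply: Rdiv_lt_0_compat; lra); lra.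
  have eta1 : eta <= 1 by apply: Rle_trans (Rmin_l _ _) (Rmin_l _ _).
  have eta2 : eta <= eps / 4 by apply: Rle_trans (Rmin_l _ _) (Rmin_r _ _).
  have eta3 : eta * (vnorm v + 1) <= d.
    have h : eta <= d / (vnorm v + 1) by apply: Rle_trans (Rmin_r _ _) (Rmin_l _ _).
    have -> : d = d / (vnorm v + 1) * (vnorm v + 1) by field; lra.
    by apply: Rmult_le_compat_r; lra.
  have eta4 : (S + 1) * eta <= eps / 4.
    have h : eta <= eps / (4 * (S + 1)) by apply: Rle_trans (Rmin_r _ _) (Rmin_r _ _).
    have -> : eps / 4 = (S + 1) * (eps / (4 * (S + 1))) by field; lra.
    by apply: Rmult_le_compat_l; lra.
  have [N hN] := ev _ eta0; exists N => k /hN [ht [hv [_ [hy _]]]].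
  have t0 := tau_gt0 k.
  have vkle : vnorm (vk k) <= vnorm v + 1 by have := vnorm_le_sub (vk k) v; lra.
  have tvE : vnorm (vscal (tau k) (vk k)) = tau k * vnorm (vk k).
    by rewrite vnorm_scal Rabs_right; lra.
  have tv : vnorm (vscal (tau k) (vk k)) < d.
    rewrite tvE; apply: Rle_lt_trans (Rmult_le_compat_l _ _ _ (Rlt_le _ _ t0) vkle) _.
    by have : tau k * (vnorm v + 1) < eta * (vnorm v + 1); [apply: Rmult_lt_compat_r; lra | lra].
  have := hd _ tv; rewrite -/(z k) tvE (linear1_scal _ linb) => hG.
  have -> : vsub (dy k) (DG zb v) = vadd (vscal (/ tau k)
      (vadd (vsub (y k) (G (z k))) (vsub (vsub (G (z k)) (G zb)) (vscal (tau k) (DG zb (vk k))))))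
      (DG zb (vsub (vk k) v)).
    rewrite (linear1_sub _ linb).
    by apply: functional_extensionality => i; rewrite /dy /vadd /vscal /vsub; field; lra.
  apply: Rle_lt_trans (vnorm_triangle _ _) _.
  have h1 : vnorm (DG zb (vsub (vk k) v)) <= eps / 4.
    apply: Rle_trans (linear1_bound _ linb _) _; rewrite -/S.
    have : S * vnorm (vsub (vk k) v) <= S * eta by apply: Rmult_le_compat_l; lra.
    lra.
  rewrite vnorm_scal Rabs_right; last by move: (itau k); lra.
  suff : / tau k * vnorm (vadd (vsub (y k) (G (z k)))
     (vsub (vsub (G (z k)) (G zb)) (vscal (tau k) (DG zb (vk k))))) <= eps / 2 by lra.
  apply: (Rmult_le_reg_l (tau k)) => //; rewrite -Rmult_assoc Rinv_r ?Rmult_1_l; last lra.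
  apply: Rle_trans (vnorm_triangle _ _) _; rewrite (vnorm_opp_sub (y k)).
  have : eps / (4 * (vnorm v + 1)) * (tau k * vnorm (vk k)) <= eps / 4 * tau k.
    have -> : eps / 4 * tau k = eps / (4 * (vnorm v + 1)) * (tau k * (vnorm v + 1)) by field; lra.
    apply: Rmult_le_compat_l; first by apply: Rlt_le; apply: Rdiv_lt_0_compat; lra.
    by apply: Rmult_le_compat_l; lra.
  have : eta * tau k <= eps / 4 * tau k by apply: Rmult_le_compat_r; lra.
  lra.
have stat u : dot lam (DG zb (vpack vzero u)) = 0.
  (* The approximate stationarity is one-sided; applying its limit to [u] and [- u] gives
     equality. *)
  suff ge0 w : 0 <= dot lam (DG zb (vpack vzero w)).
    have := ge0 (vscal (-1) u); have := ge0 u.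
    have -> : vpack vzero (vscal (-1) u) = vscal (-1) (vpack (@vzero m) u).
      apply: pair_ext; rewrite !pairE //; vring.
    by rewrite (linear1_scal _ linb) dotE; lra.
  apply: le_of_le_eps => eps eps0.
  have [Cc [d [Cc0 [[d0 dr] hDG]]]] := DG_calm _ _ _ _ _ r_gt0 G_diff DG_diff.
  set e := vpack vzero w; have ew : vnorm e = vnorm w := vnorm_vpack0 w.
  have w0 := vnorm_ge0 w; have nv := vnorm_ge0 v; have n1 := vnorm_ge0 (DG zb e).
  set K := vnorm w + vnorm (DG zb e) + a * (Cc * (vnorm v + 1) * vnorm w).
  have aC : 0 <= a * (Cc * (vnorm v + 1) * vnorm w).
    by apply: Rmult_le_pos; [lra | apply: Rmult_le_pos => //; apply: Rmult_le_pos; lra].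
  have K0 : 0 <= K by rewrite /K; lra.
  set eta := Rmin (Rmin 1 (d / (vnorm v + 1))) (eps / (K + 1)).
  have eta0 : 0 < eta.
    by rewrite /eta; do !apply: Rmin_glb_lt; try (apply: Rdiv_lt_0_compat; lra); lra.
  have eta1 : eta <= 1 by apply: Rle_trans (Rmin_l _ _) (Rmin_l _ _).
  have eta3 : eta * (vnorm v + 1) <= d.
    have h : eta <= d / (vnorm v + 1) by apply: Rle_trans (Rmin_l _ _) (Rmin_r _ _).
    have -> : d = d / (vnorm v + 1) * (vnorm v + 1) by field; lra.
    by apply: Rmult_le_compat_r; lra.
  have eta4 : K * eta <= eps.
    have h : eta <= eps / (K + 1) by exact: Rmin_r.
    have : (K + 1) * eta <= (K + 1) * (eps / (K + 1)) by apply: Rmult_le_compat_l; lra.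
    have -> : (K + 1) * (eps / (K + 1)) = eps by field; lra.
    lra.
  clearbody eta; have [N hN] := ev _ eta0; have [ht [hv [hl [_ hs]]]] := hN N (leqnn N).
  have t0 := tau_gt0 N.
  have vkle : vnorm (vk N) <= vnorm v + 1 by have := vnorm_le_sub (vk N) v; lra.
  have hz : vnorm (vsub (z N) zb) <= tau N * (vnorm v + 1).
    by rewrite zE vnorm_scal Rabs_right; [apply: Rmult_le_compat_l; lra | lra].
  have hz' : tau N * (vnorm v + 1) < eta * (vnorm v + 1) by apply: Rmult_lt_compat_r; lra.
  have hD := hDG (z N) ltac:(lra) e; rewrite ew in hD.
  have hD' : vnorm (vsub (DG (z N) e) (DG zb e)) <= Cc * (eta * (vnorm v + 1)) * vnorm w.
    apply: Rle_trans hD _; apply: Rmult_le_compat_r => //.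
    by apply: Rmult_le_compat_l => //; lra.
  have h1 := cauchy_schwarz (lamk N) (vsub (DG (z N) e) (DG zb e)).
  have h2 := Rmult_le_compat _ _ _ _ (vnorm_ge0 _) (vnorm_ge0 _) (lam_le N) hD'.
  have h3 := cauchy_schwarz (vsub (lamk N) lam) (DG zb e).
  have h4 : vnorm (vsub (lamk N) lam) * vnorm (DG zb e) <= eta * vnorm (DG zb e).
    by apply: Rmult_le_compat_r; lra.
  have h5 := hs w; rewrite -/e in h5.
  rewrite !dotE in h1 h3; move: eta4; rewrite /K; lra.
(* The sign is needed for the fixed [lam]. It is proved block by block, since the two blocks of the
   residual have different factors [s1] and [s2]. *)
have hnear : exists N, forall k, (N <= k)%nat -> 0 <= dot lam (vsub (G (z k)) (y k)).
  have [e1 [e10 h1]] := dot_ge0_near (vfst lam); have [e2 [e20 h2]] := dot_ge0_near (vsnd lam).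
  have [|N hN] := ev (Rmin e1 e2); first exact: Rmin_glb_lt.
  exists N => k /hN [_ [_ [hl _]]]; have [s1 [s2 [s10 [s20 ->]]]] := hsgn k.
  rewrite dot_pair !pairE !dotE.
  have := Rmin_l e1 e2; have := Rmin_r e1 e2.
  have := vnorm_vfst (vsub (lamk k) lam); have := vnorm_vsnd (vsub (lamk k) lam); rewrite !pairE.
  move=> g1 g2 g3 g4; apply: Rplus_le_le_0_compat; apply: Rmult_le_pos => //.
    by apply: h1; lra.
  by apply: h2; lra.
suff lam1 : vfst lam = vzero.
  have a10 : 0 < / (1 + a) by apply: Rinv_0_lt_compat; lra.
  have [N hN] := ev _ a10; have [_ [_ [hl _]]] := hN N (leqnn N).
  have := lam1_ge N; have := vnorm_le_sub (vfst (lamk N)) (vfst lam).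
  have := vnorm_vfst (vsub (lamk N) lam); rewrite pairE lam1 vnorm0; lra.
apply: (second_order v) => //.
- exists tau, (fun k => vfst (vk k)); split=> //; split=> //.
  move=> eps /vk_conv[N hN]; exists N => k /hN.
  by have := vnorm_vfst (vsub (vk k) v); rewrite pairE; lra.
- by exists tau, dy; split=> //; split=> // k; rewrite yE.
- by exists tau, dy, lamk; split=> //; split=> //; split=> // k; rewrite yE.
apply: chi_low_le_chi_up => e e0.
have [d [d0 hT]] := taylor2 _ _ _ _ _ r_gt0 G_diff DG_diff lam v e e0.
have [|N1 h1] := ev (Rmin d e); first exact: Rmin_glb_lt.
have [N2 h2] := dy_conv _ e0; have [N3 h3] := hnear.
set k := maxn N1 (maxn N2 N3).
have [ht [hv [hl _]]] := h1 k (leq_maxl _ _).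
have hdy := h2 k (leq_trans (leq_maxl _ _) (leq_maxr _ _)).
have hsg := h3 k (leq_trans (leq_maxr _ _) (leq_maxr _ _)).
have md := Rmin_l d e; have me := Rmin_r d e; have t0 := tau_gt0 k.
exists (tau k), (dy k), (vfst (vk k)); split; first lra.
split=> //; split.
  by have := vnorm_vfst (vsub (vk k) v); rewrite pairE; lra.
split=> //; split.
  (* [lam] need not be normal at [y k], but [lamk k] is, and the lower curvature only asks for
     closeness to the normal cone. *)
  apply: (ER_le_lt_trans (Fin (vnorm (vsub lam (lamk k))))); last first.
    by apply/ER_lt_Fin; rewrite vnorm_opp_sub; lra.
  by apply: vdist_le; rewrite yE; apply: lim_normal_of_reg.
have := hT (tau k) (vk k) t0 ltac:(lra) ltac:(lra); rewrite -/(z k) => {}hT.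
have linw : linear1 (fun w => DG zb (vpack w vzero)).
  move=> s t w1 w2; rewrite -linb; congr DG; apply: pair_ext; rewrite !pairE //; vring.
rewrite (dot_adj _ linw).
(* By stationarity in [x], the first-order error in the direction is seen through its parameter part
   only, which is the pairing in the upper curvature of [P]. *)
have -> : dot lam (DG zb (vpack (vsub (vfst (vk k)) (vfst v)) vzero)) =
    dot lam (DG zb (vk k)) - dot lam (DG zb v).
  rewrite -dot_subr -(linear1_sub _ linb).
  have -> : vsub (vk k) v = vadd (vpack (vsub (vfst (vk k)) (vfst v)) vzero)
      (vpack vzero (vsub (vsnd (vk k)) (vsnd v))).
    apply: pair_ext; rewrite !pairE; vring.
  by rewrite (linear1_add _ linb) dot_addr stat; ring.
have -> : dot lam (vsub (dy k) (DG zb v)) =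
    / tau k * (dot lam (y k) - dot lam (G zb)) - dot lam (DG zb v) by rewrite /dy !dotE.
apply: (Rmult_le_reg_l (tau k * tau k)); first nra.
set A := dot lam (DG zb (vk k)) in hT *; set B := dot lam (DG zb v); set Q := dot lam (D2 v v) in hT *.
have -> : tau k * tau k * ((/ tau k * (dot lam (y k) - dot lam (G zb)) - B) / tau k) =
   dot lam (y k) - dot lam (G zb) - tau k * B by field; lra.
have -> : tau k * tau k * (1 / 2 * Q + (A - B) / tau k + e) =
   tau k * tau k * (Q / 2) + tau k * (A - B) + tau k * tau k * e by field; lra.
(* The sign replaces [y k] by [G (z k)], to which the second-order expansion applies. *)
move: hsg hT; rewrite !dotE; set gz := dot lam (G (z k)).
by rewrite /Rabs; case: Rcase_abs; lra.
Qed.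

(** * Feasible points near the reference point, and stability of the whole system *)

Hypothesis first_order : forall w, tangent P pb w -> forall tau, downto0 tau ->
  exists u, forall e N, 0 < e -> exists k y, (N <= k)%nat /\ C y /\
    vnorm (vsub (vadd (G zb) (vscal (tau k) (DG zb (vpack w u)))) y) < e * tau k.

(** Condition (a) is applied along the very scales [|p_k - pb|] of a counterexample; that it
    supplies good indices only infinitely often is enough, since one large index gives the
    contradiction. *)
Lemma feasible_calm : exists K r1, 0 <= K /\ 0 < r1 /\
  forall p, P p -> vnorm (vsub p pb) < r1 ->
  exists z, C (G (vpack p z)) /\ vnorm (vsub z xb) <= K * vnorm (vsub p pb).
Proof.
apply: NNPP => hno.
have /choice[p0 hp0] k : exists p, P p /\ vnorm (vsub p pb) < / (INR k + 1) /\
    forall z, C (G (vpack p z)) -> ~ vnorm (vsub z xb) <= INR k * vnorm (vsub p pb).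
  apply: NNPP => h; apply: hno; exists (INR k), (/ (INR k + 1)); split; first exact: pos_INR.
  split; first exact: inv_succ_gt0.
  move=> p hp hpr; apply: NNPP => h'; apply: h; exists p; split=> //; split=> // z hz hzx.
  by apply: h'; exists z.
pose tau0 k := vnorm (vsub (p0 k) pb).
(* At [p = pb] the point [xb] itself would be feasible. *)
have t00 k : 0 < tau0 k.
  have [hp [_ hz]] := hp0 k; have := vnorm_ge0 (vsub (p0 k) pb); rewrite -/(tau0 k).
  have [h _|] := Req_dec (tau0 k) 0; last lra.
  case: (hz xb); last by rewrite vnorm_subxx -/(tau0 k) h; lra.
  suff -> : p0 k = pb by [].
  have -> : p0 k = vadd pb (vsub (p0 k) pb) by vring.
  rewrite (vnorm_eq0 _ h); vring.
pose w0 k := vscal (/ tau0 k) (vsub (p0 k) pb).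
have w0n k : vnorm (w0 k) = 1.
  rewrite vnorm_scal Rabs_right; last by apply: Rle_ge; apply: Rlt_le; apply: Rinv_0_lt_compat.
  by apply: Rinv_l; move: (t00 k); lra.
have [|phi [w [hphi hw]]] := bolzano_weierstrass w0 1; first by move=> k; rewrite w0n; lra.
pose tau k := tau0 (phi k).
have td : downto0 tau.
  split=> [k|eps /inv_succ_small[N hN]]; first exact: t00.
  exists N => k hk; have [_ [h _]] := hp0 (phi k).
  by have := hN _ (leq_trans hk (hphi k)); rewrite /tau /tau0; lra.
have pE k : vadd pb (vscal (tau k) (w0 (phi k))) = p0 (phi k).
  apply: functional_extensionality => i; rewrite /w0 /tau /vadd /vscal /vsub; field.
  by move: (t00 (phi k)); lra.
have wT : tangent P pb w.
  exists tau, (fun k => w0 (phi k)); split=> //; split=> // k; rewrite pE.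
  by case: (hp0 (phi k)).
have [u hu] := first_order _ wT _ td.
set v := vpack w u in hu.
have v_neq0 : v <> vzero.
  move=> v0; have [|N hN] := hw (1 / 2); first lra.
  have := hN N (leqnn N); have -> : w = vzero by have := vfst_vpack w u; rewrite -/v v0.
  have -> : vsub (w0 (phi N)) vzero = w0 (phi N) by vring.
  by rewrite w0n; lra.
have [eps [eps0 hsol]] := directional_solvability _ v_neq0.
have [L [d [L0 [[d0 dr] [_ hL]]]]] := G_lipschitz _ _ _ _ _ r_gt0 G_diff DG_diff.
have v0 := vnorm_ge0 v; have u0 := vnorm_ge0 u.
have ee : 0 < eps * eps by nra.
have [|_ /(_ (eps * eps / (3 * (vnorm v + 1))))[|d1 [d10 hd1]]] := G_diff zb.
- by rewrite vnorm_subxx.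
- by apply: Rdiv_lt_0_compat; lra.
set eta := Rmin (Rmin eps 1) (eps * eps / (3 * (L + 1))).
have eta0 : 0 < eta by do !apply: Rmin_glb_lt => //; [lra | apply: Rdiv_lt_0_compat; lra].
have eta1 : eta <= eps by apply: Rle_trans (Rmin_l _ _) (Rmin_l _ _).
have eta3 : eta <= 1 by apply: Rle_trans (Rmin_l _ _) (Rmin_r _ _).
have eta2 : L * eta <= eps * eps / 3.
  have h : eta <= eps * eps / (3 * (L + 1)) by exact: Rmin_r.
  have : (L + 1) * eta <= (L + 1) * (eps * eps / (3 * (L + 1))) by apply: Rmult_le_compat_l; lra.
  have -> : (L + 1) * (eps * eps / (3 * (L + 1))) = eps * eps / 3 by field; lra.
  lra.
set dl := Rmin eps (Rmin d1 d / (vnorm v + 2)).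
have dm := Rmin_glb_lt _ _ _ d10 d0.
have dl0 : 0 < dl by apply: Rmin_glb_lt => //; apply: Rdiv_lt_0_compat; lra.
have [N1 h1] := hw _ eta0; have [N2 h2] := proj2 td _ dl0.
have [N3 h3] := INR_unbounded (vnorm u + eps).
have [|k [y [hk [hy hly]]]] := hu (eps * eps / 3) (maxn N1 (maxn N2 N3)); first lra.
have hk1 := h1 k (leq_trans (leq_maxl _ _) hk).
have hk2 := h2 k (leq_trans (leq_trans (leq_maxl _ _) (leq_maxr _ _)) hk).
have hk3 : vnorm u + eps <= INR (phi k).
  have /leP/le_INR := leq_trans (leq_trans (leq_trans (leq_maxr _ _) (leq_maxr _ _)) hk) (hphi k).
  lra.
have t0 : 0 < tau k := t00 _.
have te : tau k < eps by have := Rmin_l eps (Rmin d1 d / (vnorm v + 2)); rewrite -/dl; lra.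
have tdl : tau k * (vnorm v + 2) < Rmin d1 d.
  have h : tau k < Rmin d1 d / (vnorm v + 2).
    by have := Rmin_r eps (Rmin d1 d / (vnorm v + 2)); rewrite -/dl; lra.
  have -> : Rmin d1 d = Rmin d1 d / (vnorm v + 2) * (vnorm v + 2) by field; lra.
  by apply: Rmult_lt_compat_r; lra.
have tvE : vnorm (vscal (tau k) v) = tau k * vnorm v by rewrite vnorm_scal Rabs_right; lra.
have md1 := Rmin_l d1 d; have md := Rmin_r d1 d.
have pw : vnorm (vsub (p0 (phi k)) (vadd pb (vscal (tau k) w))) = tau k * vnorm (vsub (w0 (phi k)) w).
  have -> : vsub (p0 (phi k)) (vadd pb (vscal (tau k) w)) = vscal (tau k) (vsub (w0 (phi k)) w).
    rewrite -pE; vring.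
  by rewrite vnorm_scal Rabs_right; lra.
have pw' : tau k * vnorm (vsub (w0 (phi k)) w) <= tau k * eta by apply: Rmult_le_compat_l; lra.
set x := vadd xb (vscal (tau k) u).
have zvE : vpack (vadd pb (vscal (tau k) w)) x = vadd zb (vscal (tau k) v).
  by apply: pair_ext; rewrite !pairE.
have zvb : vnorm (vsub (vadd zb (vscal (tau k) v)) zb) = tau k * vnorm v.
  rewrite -tvE; congr vnorm; vring.
have pvb : vnorm (vsub (vpack (p0 (phi k)) x) (vpack (vadd pb (vscal (tau k) w)) x)) <= tau k * vnorm (vsub (w0 (phi k)) w).
  by apply: Rle_trans (vsub_vpack_le _ _ _ _) _; rewrite vnorm_subxx pw; lra.
rewrite zvE in pvb.
have pvz : vnorm (vsub (vpack (p0 (phi k)) x) zb) < d.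
  have := vnorm_sub_triangle (vpack (vadd pb (vscal (tau k) w)) x) (vpack (p0 (phi k)) x) zb.
  rewrite zvE zvb.
  have : tau k * vnorm (vsub (w0 (phi k)) w) <= tau k * 1 by apply: Rmult_le_compat_l; lra.
  lra.
(* Three errors of at most [eps^2 * tau / 3] each: replacing [pb + tau * w] by the actual parameter,
   linearising [G], and the distance to [C] from (a). The radius is then [eps * tau]. *)
have hres : vnorm (vsub (G (vpack (p0 (phi k)) x)) y) <= eps * (eps * tau k).
  have g1 := hL _ (vadd zb (vscal (tau k) v)) pvz ltac:(rewrite zvb; nra).
  have g1' : L * vnorm (vsub (vpack (p0 (phi k)) x) (vadd zb (vscal (tau k) v))) <= L * (tau k * eta).
    by apply: Rmult_le_compat_l; lra.
  have g2 := hd1 (vscal (tau k) v) ltac:(rewrite tvE; nra).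
  rewrite tvE (linear1_scal _ (DG_linear_base _ _ _ _ r_gt0 G_diff)) in g2.
  have g3 : eps * eps / (3 * (vnorm v + 1)) * (tau k * vnorm v) <= eps * eps / 3 * tau k.
    have -> : eps * eps / 3 * tau k = eps * eps / (3 * (vnorm v + 1)) * (tau k * (vnorm v + 1)) by field; lra.
    apply: Rmult_le_compat_l; first by apply: Rlt_le; apply: Rdiv_lt_0_compat; lra.
    by apply: Rmult_le_compat_l; lra.
  have g4 := vnorm_sub_triangle (G (vadd zb (vscal (tau k) v))) (G (vpack (p0 (phi k)) x)) y.
  have g5 := vnorm_sub_triangle (vadd (G zb) (vscal (tau k) (DG zb v))) (G (vadd zb (vscal (tau k) v))) y.
  have g6 : vsub (vsub (G (vadd zb (vscal (tau k) v))) (G zb)) (vscal (tau k) (DG zb v))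
    = vsub (G (vadd zb (vscal (tau k) v))) (vadd (G zb) (vscal (tau k) (DG zb v))) by vring.
  rewrite g6 in g2.
  have g7 : tau k * (L * eta) <= tau k * (eps * eps / 3) by apply: Rmult_le_compat_l; lra.
  lra.
have [|||x' [hx' hC']] := hsol (tau k) (p0 (phi k)) x y (eps * tau k) (proj1 (hp0 _)) (conj t0 te) _ _ hy _ hres.
- rewrite /v vfst_vpack pw; nra.
- rewrite /v vsnd_vpack vnorm_subxx; nra.
- by split; [nra | lra].
have [_ [_ hz]] := hp0 (phi k); apply: (hz _ hC'); rewrite -/(tau0 (phi k)) -/(tau k).
have := vnorm_sub_triangle x x' xb.
have -> : vsub x xb = vscal (tau k) u by rewrite /x; vring.
rewrite vnorm_scal Rabs_right; last lra.
have : tau k * (vnorm u + eps) <= tau k * INR (phi k) by apply: Rmult_le_compat_l; lra.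
lra.
Qed.

Lemma robinson_stable_system : robinson_stable P (fun p x => G (vpack p x)) C pb xb.
Proof.
have [K [r1 [K0 [r10 hfeas]]]] := feasible_calm.
apply: NNPP => hno.
have /choice[q0 hq0] k : exists q : Vec m * Vec n * Vec (l1 + l2),
    let: (p, x, y) := q in P p /\ vnorm (vsub p pb) < / (INR k + 1) /\
    vnorm (vsub x xb) < / (INR k + 1) /\ C y /\
    forall z, C (G (vpack p z)) -> (INR k + 1) * vnorm (vsub (G (vpack p x)) y) < vnorm (vsub x z).
  apply: NNPP => h; apply: hno.
  apply: (robinson_stable_intro _ _ _ _ _ (G zb) (INR k + 1) (/ (INR k + 1))) => //.
  - by move: (pos_INR k); lra.
  - exact: inv_succ_gt0.
  move=> p x y hp hpr hxr hy; apply: NNPP => h'; apply: h; exists (p, x, y).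
  do 4 (split=> //); move=> z hz; apply: Rnot_le_lt => hle; apply: h'.
  by exists z.
pose p k := (q0 k).1.1; pose x k := (q0 k).1.2; pose y k := (q0 k).2.
have {hq0} hq k : P (p k) /\ vnorm (vsub (p k) pb) < / (INR k + 1) /\
    vnorm (vsub (x k) xb) < / (INR k + 1) /\ C (y k) /\
    forall z, C (G (vpack (p k) z)) ->
      (INR k + 1) * vnorm (vsub (G (vpack (p k) (x k))) (y k)) < vnorm (vsub (x k) z).
  by have := hq0 k; rewrite /p /x /y; case: (q0 k) => [[]].
pose d k := vnorm (vsub (G (vpack (p k) (x k))) (y k)).
pose tau k := vnorm (vsub (vpack (p k) (x k)) zb).
(* A zero residual would make [x k] feasible, against the strict inequality with [z = x k]. *)
have d_gt0 k : 0 < d k.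
  have [_ [_ [_ [hy hz]]]] := hq k; have := vnorm_ge0 (vsub (G (vpack (p k) (x k))) (y k)).
  rewrite -/(d k); have [h _|] := Req_dec (d k) 0; last lra.
  have := hz (x k); rewrite -/(d k) h vnorm_subxx => hlt.
  have : C (G (vpack (p k) (x k))).
    have -> : G (vpack (p k) (x k)) = vadd (vsub (G (vpack (p k) (x k))) (y k)) (y k) by vring.
    by rewrite (vnorm_eq0 _ h); have -> : vadd vzero (y k) = y k by vring.
  by move/hlt; lra.
have [N0 hN0] := inv_succ_small _ r10.
have hp_tau k : vnorm (vsub (p k) pb) <= tau k.
  by have := vnorm_vfst (vsub (vpack (p k) (x k)) zb); rewrite !pairE.
have hx_tau k : vnorm (vsub (x k) xb) <= tau k.
  by have := vnorm_vsnd (vsub (vpack (p k) (x k)) zb); rewrite !pairE.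
(* A feasible point lies within [(K + 1) * tau k] of [x k], while the failing error bound has
   modulus [k + 1]; so the residual is o(tau). *)
have dtau k : (N0 <= k)%nat -> (INR k + 1) * d k < (K + 1) * tau k.
  move=> /hN0 hk; have [hp [hpr [_ [_ hz]]]] := hq k.
  have [|z [hzC hzx]] := hfeas (p k) hp; first lra.
  apply: Rlt_le_trans (hz _ hzC) _.
  have := vnorm_sub_triangle xb (x k) z; rewrite (vnorm_opp_sub xb).
  have := hp_tau k; have := hx_tau k.
  have : K * vnorm (vsub (p k) pb) <= K * tau k by apply: Rmult_le_compat_l.
  lra.
have tau_gt0 k : (N0 <= k)%nat -> 0 < tau k.
  move=> /dtau; have := d_gt0 k; have := pos_INR k; have := vnorm_ge0 (vsub (vpack (p k) (x k)) zb).
  rewrite -/(tau k) => h1 h2 h3 h4.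
  have : 0 < (INR k + 1) * d k by nra.
  by nra.
have tau_le k : tau k <= 2 * / (INR k + 1).
  have [_ [h1 [h2 _]]] := hq k.
  by have := vsub_vpack_le (p k) pb (x k) xb; rewrite -/zb -/(tau k); lra.
(* Indices are shifted by [N0], beyond which [tau] is known to be positive. *)
pose v0 k := vscal (/ tau (N0 + k)%nat) (vsub (vpack (p (N0 + k)%nat) (x (N0 + k)%nat)) zb).
have v0n k : vnorm (v0 k) = 1.
  have t0 : 0 < tau (N0 + k)%nat by apply: tau_gt0; exact: leq_addr.
  rewrite vnorm_scal Rabs_right; last by apply: Rle_ge; apply: Rlt_le; apply: Rinv_0_lt_compat.
  by apply: Rinv_l; lra.
have [|phi [v [hphi hv]]] := bolzano_weierstrass v0 1; first by move=> k; rewrite v0n; lra.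
have v_neq0 : v <> vzero.
  move=> vz; have [|N hN] := hv (1 / 2); first lra.
  have := hN N (leqnn N); rewrite vz.
  have -> : vsub (v0 (phi N)) vzero = v0 (phi N) by vring.
  by rewrite v0n; lra.
have [eps [eps0 hsol]] := directional_solvability _ v_neq0.
have ee : 0 < eps * eps by nra.
have [N1 h1] := hv _ eps0.
have [|N2 h2] := inv_succ_small (eps / 2); first lra.
have [|N3 h3] := inv_succ_small (eps * eps / (K + 1)); first by apply: Rdiv_lt_0_compat; lra.
have [|N4 h4] := inv_succ_small eps; first lra.
set j := maxn N1 (maxn N2 (maxn N3 N4)); set k := (N0 + phi j)%nat.
have jk : (j <= k)%nat by apply: leq_trans (hphi j) (leq_addl _ _).
have hk0 : (N0 <= k)%nat by exact: leq_addr.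
have hj1 := h1 j (leq_maxl _ _).
have hk2 := h2 k (leq_trans (leq_trans (leq_maxl _ _) (leq_maxr _ _)) jk).
have hk3 := h3 k (leq_trans (leq_trans (leq_trans (leq_maxl _ _) (leq_maxr _ _)) (leq_maxr _ _)) jk).
have hk4 := h4 k (leq_trans (leq_trans (leq_trans (leq_maxr _ _) (leq_maxr _ _)) (leq_maxr _ _)) jk).
have t0 := tau_gt0 _ hk0; have dt := dtau _ hk0; have dk := d_gt0 k.
have ik := inv_succ_gt0 k; have Ik := pos_INR k.
have iE : / (INR k + 1) * (INR k + 1) = 1 by apply: Rinv_l; lra.
have [hp [_ [_ [hy hz]]]] := hq k.
have near : vnorm (vsub (vsub (vpack (p k) (x k)) zb) (vscal (tau k) v)) <= eps * tau k.
  have -> : vsub (vsub (vpack (p k) (x k)) zb) (vscal (tau k) v) = vscal (tau k) (vsub (v0 (phi j)) v).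
    by apply: functional_extensionality => i; rewrite /v0 -/k /vscal /vsub; field; lra.
  rewrite vnorm_scal Rabs_right; last lra.
  by rewrite Rmult_comm; apply: Rmult_le_compat_r; lra.
have dd : d k <= eps * eps * tau k.
  have e1 : (K + 1) * / (INR k + 1) <= eps * eps.
    have -> : eps * eps = (K + 1) * (eps * eps / (K + 1)) by field; lra.
    by apply: Rmult_le_compat_l; lra.
  have : d k <= (K + 1) * / (INR k + 1) * tau k.
    apply: (Rmult_le_reg_l (INR k + 1)); first lra.
    have -> : (INR k + 1) * ((K + 1) * / (INR k + 1) * tau k) = (K + 1) * tau k by field; lra.
    lra.
  have : (K + 1) * / (INR k + 1) * tau k <= eps * eps * tau k by apply: Rmult_le_compat_r; lra.
  lra.
have hte : tau k < eps by have := tau_le k; lra.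
(* The radius [d k / eps] is the smallest one allowed by the residual. It is admissible as
   [d k <= eps^2 * tau k], and it is at most [(k + 1) * d k] since [1 / (k + 1) < eps], against the
   choice of the point. *)
have [||||x' [hx' hC']] := hsol (tau k) (p k) (x k) (y k) (d k / eps) hp (conj t0 hte) _ _ hy _ _.
- apply: Rle_trans near.
  have := vnorm_vfst (vsub (vsub (vpack (p k) (x k)) zb) (vscal (tau k) v)); rewrite !pairE.
  have -> // : vsub (vsub (p k) pb) (vscal (tau k) (vfst v)) = vsub (p k) (vadd pb (vscal (tau k) (vfst v))).
  vring.
- apply: Rle_trans near.
  have := vnorm_vsnd (vsub (vsub (vpack (p k) (x k)) zb) (vscal (tau k) v)); rewrite !pairE.
  have -> // : vsub (vsub (x k) xb) (vscal (tau k) (vsnd v)) = vsub (x k) (vadd xb (vscal (tau k) (vsnd v))).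
  vring.
- split; first exact: Rdiv_lt_0_compat.
  apply: (Rmult_le_reg_l eps) => //.
  have -> : eps * (d k / eps) = d k by field; lra.
  lra.
- apply: Req_le; rewrite -/(d k); field; lra.
have := hz _ hC'; rewrite (vnorm_opp_sub (x k)) -/(d k) => hlt.
have : d k / eps <= (INR k + 1) * d k.
  apply: (Rmult_le_reg_l eps) => //.
  have -> : eps * (d k / eps) = d k by field; lra.
  have : 1 <= eps * (INR k + 1).
    have : / (INR k + 1) * (INR k + 1) <= eps * (INR k + 1) by apply: Rmult_le_compat_r; lra.
    lra.
  by nra.
lra.
Qed.
End System.

(** * Transfer to the two-variable formulation *)

Theorem theorem4p3
  (m n l1 l2 : nat) (P : Vec m -> Prop) (pb : Vec m) (xb : Vec n)
  (C1 : Vec l1 -> Prop) (C2 : Vec l2 -> Prop)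
  (g : Vec m -> Vec n -> Vec (l1 + l2))
  (Dg : Vec m -> Vec n -> Vec m -> Vec n -> Vec (l1 + l2))
  (D2g : Vec m -> Vec n -> Vec m -> Vec n -> Vec (l1 + l2))
  (Dxg : Vec m -> Vec n -> Vec n -> Vec (l1 + l2))
  (* C_i closed, (pb, xb) in gph Gamma *)
  (HC1 : closed C1) (HC2 : closed C2)
  (HPpb : P pb) (Hgph : setprod C1 C2 (g pb xb))
  (* g twice (Frechet) differentiable at (pb, xb): differentiable on a
     neighborhood with derivative Dg, and Dg differentiable at (pb, xb) with
     derivative D2g, i.e. D2g h k = (d/dz Dg(z) k)(pb, xb) h *)
  (Hdiff : exists r, 0 < r /\ forall p x, vnorm (vsub p pb) < r -> vnorm (vsub x xb) < r ->
             frechet2 g (Dg p x) p x)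
  (Hdiff2 : forall w2 u2,
             frechet2 (fun p x => Dg p x w2 u2) (fun w1 u1 => D2g w1 u1 w2 u2) pb xb)
  (* standing assumptions *)
  (Hstand : exists r, 0 < r /\
     (forall p, P p -> vnorm (vsub p pb) < r ->
        forall x, vnorm (vsub x xb) < r ->
          frechet1 (g p) (Dxg p x) x /\
          (forall u eps, 0 < eps -> exists delta, 0 < delta /\
             forall x', vnorm (vsub x' xb) < r -> vnorm (vsub x' x) < delta ->
               vnorm (vsub (Dxg p x' u) (Dxg p x u)) < eps)) /\
     (forall eps, 0 < eps -> exists delta, 0 < delta /\
        forall p x, vnorm (vsub p pb) < delta -> vnorm (vsub x xb) < delta ->
          vnorm (vsub (g p x) (g pb xb)) < eps) /\
     (forall u eps, 0 < eps -> exists delta, 0 < delta /\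
        forall p x, P p -> vnorm (vsub p pb) < r -> vnorm (vsub x xb) < r ->
          vnorm (vsub p pb) < delta -> vnorm (vsub x xb) < delta ->
          vnorm (vsub (Dxg p x u) (Dxg pb xb u)) < eps))
  (* (a) *)
  (Ha : forall w, tangent P pb w -> forall tau : nat -> R, downto0 tau ->
          exists u : Vec n,
            ER_liminf (fun k => ER_scale (/ tau k)
              (vdist (vadd (g pb xb) (vscal (tau k) (Dg pb xb w u))) (setprod C1 C2)))
            = Fin 0)
  (* (b) *)
  (Hb : robinson_stable P (fun p x => vsnd (g p x)) C2 pb xb)
  (* (c) *)
  (Hc : forall (w : Vec m) (u : Vec n) (lam : Vec (l1 + l2)),
          (w, u) <> (vzero, vzero) ->
          tangent P pb w ->
          tangent (setprod C1 C2) (g pb xb) (Dg pb xb w u) ->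
          dir_normal (setprod C1 C2) (g pb xb) (Dg pb xb w u) lam ->
          adj (fun u' => Dg pb xb vzero u') lam = vzero ->
          ER_le (chi_low (setprod C1 C2) lam (g pb xb) (Dg pb xb w u))
                (ER_addr ((1/2) * dot lam (D2g w u w u))
                   (chi_up P (adj (fun w' => Dg pb xb w' vzero) lam) pb w)) ->
          vfst lam = vzero) :
  robinson_stable P g (setprod C1 C2) pb xb.
Proof.
(* The system is read in one packed variable; [nrm2] is the norm of the packed vector, so the
   derivatives transfer with the same remainder estimates. *)
set G := fun z : Vec (m + n) => g (vfst z) (vsnd z).
set DG := fun z h : Vec (m + n) => Dg (vfst z) (vsnd z) (vfst h) (vsnd h).
set D2 := fun k h : Vec (m + n) => D2g (vfst k) (vsnd k) (vfst h) (vsnd h).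
set zb := vpack pb xb.
have gE p x : G (vpack p x) = g p x by rewrite /G !pairE.
have [r [r0 hr]] := Hdiff.
have G_diff z : vnorm (vsub z zb) < r -> frechet1 G (DG z) z.
  move=> hz; have := vnorm_vfst (vsub z zb); have := vnorm_vsnd (vsub z zb).
  rewrite !pairE => h1 h2; have [||lin hd] := hr (vfst z) (vsnd z); try lra.
  split=> [s t u v|eps /hd[d [d0 {}hd]]]; first exact: lin.
  by exists d; split=> // u; rewrite vnorm_nrm2 => /hd.
have DG_diff h : frechet1 (fun z => DG z h) (fun k => D2 k h) zb.
  have [lin hd] := Hdiff2 (vfst h) (vsnd h).
  split=> [s t u v|eps /hd[d [d0 {}hd]]]; first exact: lin.
  exists d; split=> // u; rewrite vnorm_nrm2 => /hd.
  by rewrite /DG /zb !pairE.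
have DGE w u : DG zb (vpack w u) = Dg pb xb w u by rewrite /DG /zb !pairE.
have DGE' v : DG zb v = Dg pb xb (vfst v) (vsnd v) by rewrite /DG /zb !pairE.
have funE : (fun (p : Vec m) (x : Vec n) => G (vpack p x)) = g.
  by apply: functional_extensionality => p; apply: functional_extensionality => x.
rewrite -funE.
apply: (robinson_stable_system P pb xb C1 C2 G DG D2 r) => //.
- by rewrite gE.
- by move: Hb; rewrite -funE.
- move=> v lam v0 hP hT hN hst hchi.
  rewrite -/zb gE DGE' in hT hN hchi.
  apply: (Hc (vfst v) (vsnd v) lam) => //.
  + by case=> h1 h2; apply: v0; apply: pair_ext.
  + apply: functional_extensionality => j.
    by have := hst (ebasis j); rewrite DGE.
  + have h : (fun w => Dg pb xb w vzero) = (fun w => DG zb (vpack w vzero)).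
    by apply: functional_extensionality => w; rewrite DGE.
    by rewrite h.
- move=> w hw tau htau; have [u hu] := Ha w hw tau htau; exists u => e N e0.
  have [k [y [hk [hy hd]]]] := liminf_vdist _ _ _ (proj1 htau) hu e N e0.
  by exists k, y; rewrite -/zb gE DGE.
Qed.
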